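(* Let $A=\{a_n\}_{n=1}^{\infty}$ be a sequence of positive integers (not necessarily distinct). Put \begin{align*} N_A(x)&=\#\{j\in\mathbb{N}:\ a_j\leq x\},\\ \mathrm{ord}_A(n)&=\#\{j\in\mathbb{N}:\ a_j=n\},\qquad n\in\mathbb{N},\\ \rho_A(x)&=\max_{n\leq x}\mathrm{ord}_A(n). \end{align*} Suppose that $\mathrm{ord}_A(n)<+\infty$ for any positive integer $n$. Suppose that there are constants $\gamma_1>0$, $\gamma_2>0$, $\alpha>0$, $x_0\geq 10$ such that for any real number $x\geq x_0$ we have \[ N_A(x)>0,\qquad N_A\left(\frac{x}{2}\right)\geq\gamma_1N_A(x), \] \[ \sum_{\substack{k\in\mathbb{N}:\\ a_k<x}}\ \sum_{p\leq(\ln x)^{\alpha}}\frac{\#\{j\in\mathbb{N}:\ a_k<a_j\leq x\ \text{and}\ a_j\equiv a_k\ (\mathrm{mod}\ p)\}\,\ln p}{p}\leq\gamma_2(N_A(x))^2. \] For any positive integer $n$, put \[ r(n)=\#\{(p,j)\in\mathbb{P}\times\mathbb{N}:\ p+a_j=n\}. \] Then there are constants $c_1=c_1(\gamma_1)>0$, depending only on $\gamma_1$, and $c_2=c_2(\gamma_1,\gamma_2,\alpha)>0$, depending only on $\gamma_1,\gamma_2,\alpha$, such that \[ \#\left\{1\leq n\leq x:\ r(n)\geq c_1\frac{N_A(x)}{\ln x}\right\}\geq c_2x\,\frac{N_A(x)}{N_A(x)+\rho_A(x)\ln x} \] for any real number $x\geq x_0$. In particular, \[ \#\{1\leq n\leq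 x:\ \text{there are } p\in\mathbb{P}\text{ and } j\in\mathbb{N}\text{ such that } p+a_j=n\}\geq c_2x\,\frac{N_A(x)}{N_A(x)+\rho_A(x)\ln x} \] for any real number $x\geq x_0$.
   Context: $\mathbb{N}$ is the set of positive integers, $\mathbb{P}$ the set of prime numbers; $p$ denotes a prime, so the sum over $p\leq K$ is over all primes not exceeding $K$; the variable $n$ in $\max_{n\leq x}$ and in the counted sets runs over positive integers. $\ln$ is the natural logarithm. The constants depend on the sequence $A$ only through the indicated parameters. *)

(* Defs.v *)
From HB Require Import structures.
From mathcomp Require Import all_boot all_order all_algebra.
From mathcomp Require Import finmap.
From mathcomp Require Import all_classical all_reals all_analysis.

Set Implicit Arguments.
Unset Strict Implicit.
Unset Printing Implicit Defensive.

Import Order.TTheory GRing.Theory Num.Theory.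

Local Open Scope classical_set_scope.
Local Open Scope ring_scope.

(* A sequence (a_n)_{n >= 1} of positive integers is a function [a : nat -> nat]
   with positive values, the term a_n being [a n.-1]. *)

(* Meaningful for finite sets only: [fset_set S] is empty when S is infinite.
   All the sets counted below are finite as soon as a takes every value
   finitely often. *)
Definition ncard (T : choiceType) (S : set T) : nat := #|` fset_set S|.

Definition countA (R : realType) (a : nat -> nat) (x : R) : nat :=
  ncard [set j : nat | (a j)%:R <= x].

Definition ordA (a : nat -> nat) (n : nat) : nat :=
  ncard [set j : nat | a j = n].

Definition rhoA (R : realType) (a : nat -> nat) (x : R) : nat :=
  (\max_(1 <= n < (Num.truncn x).+1) ordA a n)%N.

Definition reprA (a : nat -> nat) (n : nat) : nat :=
  ncard [set pj : nat * nat | prime pj.1 /\ (pj.1 + a pj.2)%N = n].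

Definition congA (R : realType) (a : nat -> nat) (x : R) (k p : nat) : nat :=
  ncard [set j : nat |
    [/\ (a k < a j)%N, (a j)%:R <= x & a j = a k %[mod p]]].

(* Main.v *)
Require Import Defs.
From HB Require Import structures.
From mathcomp Require Import all_boot all_order all_algebra.
From mathcomp Require Import finmap.
From mathcomp Require Import all_classical all_reals all_analysis.
From mathcomp Require Import zify ring lra.

Set Implicit Arguments.
Unset Strict Implicit.
Unset Printing Implicit Defensive.

Import Order.TTheory GRing.Theory Num.Theory.

Local Open Scope classical_set_scope.
Local Open Scope ring_scope.

(** This is a second moment argument in the style of Romanov. Write N for the
    number of terms a_j <= x and L for ln x.

    The sum of r(n) over n <= x is at least N(x/2) * pi(x/2), which by the
    doubling hypothesis and Chebyshev's lower bound is at least a constant times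
    x N / L. The n with r(n) < c1 N / L contribute at most half of that, so the
    sum restricted to the remaining n, those which are to be counted, has the
    same order. By Cauchy-Schwarz the number of these n is at least the square
    of that sum divided by the sum of r(n)^2.

    The sum of r(n)^2 counts solutions of p + a_i = q + a_j in primes p, q. The
    solutions with a_i = a_j number at most pi(x) N rho. For a_i < a_j, setting
    h = a_j - a_i, one counts primes q <= x with q + h prime; Selberg's sieve
    (selberg_sieve, prime_pairs_le) bounds their number by a constant times
    x / L^2 * h / phi(h), uniformly in h.

    It remains to average h / phi(h). The hypothesis controls the sum S(h) of
    ln p / p over the primes p <= L^alpha dividing h, and the point is that
    h / phi(h) is at most a constant times 1 + S(h) (euler_ratio_le): the
    product of 1 + 1/p over any finite set of primes is at most 4 + 4 times the
    sum of ln p / p over it (prod_1Dinv_le), while the prime factors of h beyond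
    L^alpha only change h / phi(h) by a factor bounded in terms of alpha. Hence
    the sum of r(n)^2 is at most a constant times x N (N + rho L) / L^2, and the
    theorem follows.

    Two elementary devices carry the analytic work. One is the upper half of
    Mertens' first theorem (mertens_le). The other is Rankin's trick
    (rankin_ge): a truncated sum of a multiplicative function over squarefree
    integers keeps half of the full Euler product once the truncation point is
    large enough. It yields both the sieve main term and prod_1Dinv_le. *)

(** * Chebyshev bounds and Mertens' first theorem *)

Definition primes_upto (n : nat) : seq nat := [seq p <- iota 0 n.+1 | prime p].

Lemma mem_primes_upto n p : (p \in primes_upto n) = (prime p && (p <= n)%N).
Proof. by rewrite mem_filter mem_iota. Qed.

Lemma primes_upto_uniq n : uniq (primes_upto n).
Proof. by rewrite filter_uniq // iota_uniq. Qed.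

Lemma primes_upto_prime n : all prime (primes_upto n).
Proof. exact: filter_all. Qed.

Lemma primes_uptoD m k :
  primes_upto (m + k) = primes_upto m ++ [seq p <- iota m.+1 k | prime p].
Proof. by rewrite /primes_upto -addSn iotaD filter_cat. Qed.

(** Powers of distinct primes are pairwise coprime, so separate divisibilities
    multiply up. *)
Lemma prod_prime_pow_dvd (s : seq nat) (e : nat -> nat) (m : nat) :
  uniq s -> all prime s -> (forall p, p \in s -> (p ^ e p %| m)%N) ->
  (\prod_(p <- s) p ^ e p %| m)%N.
Proof.
elim: s => [|p s IHs] /=; first by rewrite big_nil dvd1n.
move=> /andP[pNs us] /andP[pp ps] dvd_m; rewrite big_cons Gauss_dvd.
  rewrite dvd_m ?mem_head //= IHs // => q qs.
  by apply: dvd_m; rewrite inE qs orbT.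
apply: (@unstable.coprime_prodr nat s xpredT (fun q => (q ^ e q)%N) p s).
rewrite filter_predT; apply/allP => _ /mapP[q qs ->].
rewrite coprimeXl // coprimeXr // prime_coprime //.
rewrite dvdn_prime2 //; last exact: (allP ps).
by apply: contra pNs => /eqP->.
Qed.

(** Row 2m + 1 of Pascal's triangle sums to 2 * 4 ^ m and contains this
    coefficient twice. *)
Lemma bin_odd_le m : ('C((2 * m).+1, m) <= 4 ^ m)%N.
Proof.
have le_m : (m <= (2 * m).+1)%N by lia.
suff : (2 * 'C((2 * m).+1, m) <= 2 ^ (2 * m).+1)%N.
  by rewrite expnS expnM leq_pmul2l.
have -> : (2 ^ (2 * m).+1 = \sum_(i < (2 * m).+2) 'C((2 * m).+1, i))%N.
  by rewrite -[2%N]/(1 + 1)%N expnDn; apply: eq_bigr => i _; rewrite !exp1n !muln1.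
have h1 : (m < (2 * m).+2)%N by lia.
have h2 : (m.+1 < (2 * m).+2)%N by lia.
rewrite (bigD1 (Ordinal h1)) //= (bigD1 (Ordinal h2)) /=; last first.
  by rewrite -val_eqE /=; lia.
rewrite mul2n -addnn addnA.
rewrite -[X in (_ + X <= _)%N](@bin_sub (2 * m).+1 m) //.
have -> : ((2 * m).+1 - m = m.+1)%N by lia.
by rewrite leq_addr.
Qed.

(** Strong induction on n. For n = 2m + 1 every prime in ]m + 1, 2m + 1] divides
    the binomial coefficient of bin_odd_le; an even n > 2 adds no prime. *)
Lemma primorial_le n : (\prod_(p <- primes_upto n) p <= 4 ^ n)%N.
Proof.
elim/ltn_ind: n => n IHn.
case: (leqP n 2) => [|n_gt2].
  by case: n {IHn} => [|[|[|]]] // _; rewrite /primes_upto /= ?unlock //=.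
case: (boolP (odd n)) => [n_odd|n_even].
  have [m def_n m_gt0] : exists2 m, n = (m.+1 + m)%N & (0 < m)%N.
    by exists n./2; have := odd_double_half n; rewrite n_odd; lia.
  rewrite def_n primes_uptoD big_cat /= expnD leq_mul //; first by apply: IHn; lia.
  apply: leq_trans (bin_odd_le m); apply: dvdn_leq; first by rewrite bin_gt0; lia.
  have := @prod_prime_pow_dvd [seq p <- iota m.+2 m | prime p] (fun=> 1%N).
  under eq_bigr => i _ do rewrite expn1.
  apply; rewrite ?filter_uniq ?iota_uniq ?filter_all // => p.
  rewrite mem_filter mem_iota expn1 => /andP[pp p_m].
  have : (p %| 'C((2 * m).+1, m) * (m`! * ((2 * m).+1 - m)`!))%N.
    by rewrite bin_fact; [apply: dvdn_fact; lia | lia].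
  have pNfact k : (k < p)%N -> ~~ (p %| k`!)%N.
    elim: k => [|k IHk] k_p; first by rewrite fact0 Euclid_dvd1.
    rewrite factS Euclid_dvdM // negb_or IHk ?andbT; last by lia.
    by apply/negP => /(dvdn_leq (ltn0Sn k)); lia.
  rewrite !Euclid_dvdM // (negbTE (pNfact m _)); last by lia.
  by rewrite (negbTE (pNfact _ _)) ?orbF //; lia.
case: n n_gt2 n_even IHn => // n n_gt2 n_even IHn.
have nNp : ~~ prime n.+1.
  apply/negP => pn; have : (n.+1 == 2)%N.
    rewrite eq_sym -dvdn_prime2 // dvdn2 /=; exact: n_even.
  by lia.
have -> : primes_upto n.+1 = primes_upto n.
  by rewrite -addn1 primes_uptoD /= (negbTE nNp) cats0.
rewrite expnS.
by apply: leq_trans (IHn n (ltnSn n)) _; lia.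
Qed.

Section Mertens.
Context {R : realType}.
Implicit Types n m p : nat.

Lemma ln_prod (s : seq nat) (F : nat -> R) :
  {in s, forall i, 0 < F i} -> ln (\prod_(i <- s) F i) = \sum_(i <- s) ln (F i).
Proof.
elim: s => [|p s IHs] F0; first by rewrite !big_nil ln1.
have F0' : {in s, forall i, 0 < F i} by move=> i si; apply: F0; rewrite inE si orbT.
rewrite !big_cons lnM ?IHs ?posrE ?F0 ?mem_head //.
by rewrite big_seq; apply: prodr_gt0 => i /F0'.
Qed.

Lemma ler_lnN m n : (0 < m)%N -> (m <= n)%N -> ln m%:R <= ln n%:R :> R.
Proof.
by move=> m0 mn; rewrite ler_ln ?posrE ?ltr0n ?ler_nat //; apply: leq_trans mn.
Qed.

Lemma lnN_ge0 n : 0 <= ln n%:R :> R.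
Proof. by case: n => [|n]; [rewrite ln0 | rewrite ln_ge0 // ler1n]. Qed.

Lemma lnN_gt0 n : (1 < n)%N -> 0 < ln n%:R :> R.
Proof. by move=> n1; rewrite ln_gt0 // ltr1n. Qed.

(** Crude numerical bounds suffice, since none of the constants is sharp. *)
Lemma ln2_bounds : 1 / 2 <= ln 2 :> R /\ ln 2 <= 1 :> R.
Proof.
split; last first.
  by have := @le_ln1Dx R 1; apply; lra.
have := @le_ln1Dx R (- (1 / 2)); rewrite (_ : 1 + - (1 / 2) = 2^-1 :> R); last by field.
by rewrite lnV ?posrE; [lra|lra].
Qed.

Lemma ln4_bounds : 1 <= ln 4 :> R /\ ln 4 <= 2 :> R.
Proof.
have -> : 4 = 2 ^+ 2 :> R by ring.
by rewrite lnXn //; have [] := ln2_bounds; lra.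
Qed.

(** The logarithm of the primorial bound, with ln 4 rounded up to 2. *)
Lemma theta_le n : \sum_(p <- primes_upto n) ln p%:R <= 2 * n%:R :> R.
Proof.
rewrite -ln_prod; last first.
  by move=> p; rewrite mem_primes_upto ltr0n => /andP[/prime_gt0].
apply: (@le_trans _ _ (ln ((4 ^ n)%N%:R))).
  rewrite -natr_prod ler_lnN ?primorial_le // big_seq prodn_cond_gt0 // => p.
  by rewrite mem_primes_upto => /andP[/prime_gt0].
by rewrite natrX lnXn // -[leLHS]mulr_natr ler_wpM2r //; case: ln4_bounds.
Qed.

Lemma expn_divn_dvd_fact p n : prime p -> (p ^ (n %/ p) %| n`!)%N.
Proof.
move=> pp; rewrite pfactor_dvdn ?fact_gt0 // logn_fact //.
by case: n => [|n]; rewrite ?div0n // big_ltn // expn1 leq_addr.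
Qed.

Lemma fact_le_expn n : (n`! <= n ^ n)%N.
Proof.
elim: n => // n IHn; rewrite factS expnS leq_mul2l /=.
by apply: leq_trans IHn _; case: n => // n; rewrite leq_exp2r.
Qed.

(** The upper half of Mertens' first theorem. The product of the
    p ^ floor(n / p), which is the first term of Legendre's formula, divides n!
    and n! <= n ^ n; replacing floor(n / p) by n / p costs at most the sum of
    ln p bounded in theta_le. *)
Lemma mertens_le n : (0 < n)%N ->
  \sum_(p <- primes_upto n) ln p%:R / p%:R <= ln n%:R + 2 :> R.
Proof.
move=> n0.
have pos p : p \in primes_upto n -> (0 < p)%N.
  by rewrite mem_primes_upto => /andP[/prime_gt0].
have H1 : \sum_(p <- primes_upto n) (n %/ p)%N%:R * ln p%:R <= n%:R * ln n%:R :> R.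
  have -> : n%:R * ln n%:R = ln (n ^ n)%N%:R :> R.
    by rewrite natrX lnXn ?ltr0n // mulr_natl.
  have -> : \sum_(p <- primes_upto n) (n %/ p)%N%:R * ln p%:R =
     ln (\prod_(p <- primes_upto n) p ^ (n %/ p))%N%:R :> R.
    rewrite natr_prod ln_prod; last first.
      by move=> p /pos p0; rewrite natrX exprn_gt0 // ltr0n.
    rewrite !big_seq; apply: eq_bigr => p /pos p0.
    by rewrite natrX lnXn ?ltr0n // mulr_natl.
  rewrite ler_lnN //.
    by rewrite big_seq prodn_cond_gt0 // => p /pos p0; rewrite expn_gt0 p0.
  apply: leq_trans (fact_le_expn n); apply: dvdn_leq; first exact: fact_gt0.
  apply: prod_prime_pow_dvd; rewrite ?primes_upto_uniq ?primes_upto_prime // => p.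
  by rewrite mem_primes_upto => /andP[pp _]; apply: expn_divn_dvd_fact.
have H2 : n%:R * (\sum_(p <- primes_upto n) ln p%:R / p%:R) <=
   \sum_(p <- primes_upto n) ((n %/ p)%N%:R * ln p%:R + ln p%:R) :> R.
  rewrite mulr_sumr !big_seq; apply: ler_sum => p /pos p0.
  have -> : (n %/ p)%N%:R * ln p%:R + ln p%:R = (n %/ p).+1%:R * ln p%:R :> R.
    by rewrite -natr1; ring.
  rewrite mulrCA [leRHS]mulrC ler_wpM2l ?lnN_ge0 //.
  rewrite ler_pdivrMr ?ltr0n // -natrM ler_nat.
  by rewrite ltnW // ltn_ceil.
have := le_trans H2; move/(_ (n%:R * (ln n%:R + 2))).
rewrite ler_pM2l ?ltr0n //; apply.
rewrite big_split /= mulrDr lerD // mulrC; exact: theta_le.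
Qed.

(** Primes above the square root of n have ln p >= (ln n) / 2, so theta_le
    bounds their number; the others are at most sqrt n in number. *)
Lemma prime_count_le n : (0 < n)%N ->
  (size (primes_upto n))%:R * ln n%:R <= 6 * n%:R :> R.
Proof.
move=> n0.
have [m m_n n_m] : exists2 m, (m * m <= n)%N & (n < m.+1 * m.+1)%N.
  have ex : exists m, (m * m <= n)%N by exists 0%N.
  have bd m : (m * m <= n)%N -> (m <= n)%N by case: m => // m; nia.
  case: (ex_maxnP ex bd) => m m_n m_max; exists m => //.
  by rewrite ltnNge; apply/negP => /m_max; rewrite ltnn.
have ln_le : ln n%:R <= 2 * ln m.+1%:R :> R.
  rewrite mulr_natl -lnXn // -natrX ler_lnN //; lia.
have lnm : ln m.+1%:R <= m%:R :> R.
  by have := @le_ln1Dx R m%:R; rewrite -natr1 addrC; apply; have := ler0n R m; lra.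
have cnt : (size (primes_upto n))%:R * ln m.+1%:R
    <= m%:R * ln m.+1%:R + 2 * n%:R :> R.
  have le_m_n : (m <= n)%N by case: m m_n {n_m ln_le lnm} => // m; nia.
  apply: le_trans (lerD (lexx _) (theta_le n)).
  rewrite -(subnKC le_m_n) primes_uptoD size_cat natrD mulrDl big_cat /=.
  apply: lerD.
    rewrite ler_wpM2r ?lnN_ge0 // ler_nat.
    rewrite /primes_upto /= (leq_trans (size_subseq (filter_subseq _ _))) //.
    by rewrite size_iota.
  rewrite -[leLHS]add0r lerD //.
    by apply: sumr_ge0 => p _; rewrite lnN_ge0.
  rewrite -sum1_size natr_sum mulr_suml !big_seq; apply: ler_sum => p.
  rewrite mem_filter mem_iota mul1r => /and3P[pp m_p _].
  by rewrite ler_lnN.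
have m2 : m%:R * m%:R <= n%:R :> R by rewrite -natrM ler_nat.
have s0 : 0 <= (size (primes_upto n))%:R :> R by [].
have m0 : 0 <= m%:R :> R by [].
have l0 : 0 <= ln m.+1%:R :> R by exact: lnN_ge0.
have h1 := ler_wpM2l s0 ln_le.
have h2 := ler_wpM2l m0 lnm.
lra.
Qed.
End Mertens.

(** By Pascal's rule C(2n + 2, n + 1) = 2 C(2n + 1, n) >= 2 C(2n, n). *)
Lemma exp2_le_bin n : (2 ^ n <= 'C(2 * n, n))%N.
Proof.
elim: n => [|n IHn]; first by rewrite bin0.
have -> : (2 * n.+1 = (2 * n).+2)%N by lia.
rewrite binS.
have -> : ('C((2 * n).+1, n.+1) = 'C((2 * n).+1, n))%N.
  by rewrite -[RHS]bin_sub; [congr binomial; lia | lia].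
rewrite addnn -mul2n expnS leq_mul2l /=.
apply: leq_trans IHn _.
case: n => [|n]; first by rewrite !bin0.
by rewrite [leqRHS]binS leq_addr.
Qed.

(** In Legendre's formula for the exponent of p in C(2n, n), each k contributes
    floor(2n / p^k) - 2 floor(n / p^k), which is at most 1, and is 0 once
    p^k > 2n. *)
Lemma prime_pow_logn_bin_le n p : prime p -> (0 < n)%N ->
  (p ^ logn p 'C(2 * n, n) <= 2 * n)%N.
Proof.
move=> pp n0; have p1 := prime_gt1 pp.
have n2 : (0 < 2 * n)%N by lia.
set L := trunc_log p (2 * n).
suff le_L : (logn p 'C(2 * n, n) <= L)%N.
  apply: leq_trans (trunc_logP p1 n2); by rewrite leq_exp2l.
have facE : logn p n`! = (\sum_(1 <= k < (2 * n).+1) n %/ p ^ k)%N.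
  rewrite logn_fact // [RHS](@big_cat_nat _ _ _ n.+1) //=; last by lia.
  rewrite [X in (_ + X)%N]big_nat_cond [X in (_ + X)%N]big1 ?addn0 // => k.
  rewrite andbT => /andP[nk _]; apply: divn_small.
  by apply: leq_trans nk _; apply/ltnW/ltn_expl.
have : logn p (2 * n)`! = (logn p 'C(2 * n, n) + 2 * logn p n`!)%N.
  have le_n : (n <= 2 * n)%N by lia.
  rewrite -(bin_fact le_n) (_ : (2 * n - n = n)%N); last by lia.
  by rewrite !lognM ?muln_gt0 ?fact_gt0 ?bin_gt0 ?le_n //; lia.
(* Both Legendre sums now run over the same range of k. *)
rewrite facE (logn_fact _ pp) => eq_sum.
suff : (\sum_(1 <= k < (2 * n).+1) (2 * n) %/ p ^ k <=
   L + 2 * \sum_(1 <= k < (2 * n).+1) n %/ p ^ k)%N by lia.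
apply: (@leq_trans (\sum_(1 <= k < (2 * n).+1) ((k <= L)%N + 2 * (n %/ p ^ k)))%N).
  apply: leq_sum => k _.
  have pk0 : (0 < p ^ k)%N by rewrite expn_gt0 ltnW.
  case: (leqP k L) => [_|Lk].
    rewrite add1n -ltnS ltn_divLR // {1}(divn_eq n (p ^ k)).
    by have := ltn_pmod n pk0; nia.
  rewrite divn_small //; apply: leq_trans (trunc_log_ltn (2 * n) p1) _.
  by rewrite leq_exp2l.
rewrite big_split /= -big_distrr /= leq_add2r.
have -> : (\sum_(1 <= k < (2 * n).+1) (k <= L)%N = count (fun k => k <= L)%N (index_iota 1 (2 * n).+1))%N.
  by rewrite -sum1_count [RHS]big_mkcond /=; apply: eq_bigr => k _; case: (k <= L)%N.
rewrite -size_filter -[X in (_ <= X)%N](size_iota 1 L).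
apply: uniq_leq_size; first by rewrite filter_uniq // iota_uniq.
by move=> k; rewrite mem_filter !mem_iota; lia.
Qed.

(** All prime powers in the factorisation of C(2n, n) are at most 2n, and its
    primes are at most 2n as well. *)
Lemma bin_le_prime_count n : (0 < n)%N ->
  ('C(2 * n, n) <= (2 * n) ^ size (primes_upto (2 * n)))%N.
Proof.
move=> n0; have le_n : (n <= 2 * n)%N by lia.
have b0 : (0 < 'C(2 * n, n))%N by rewrite bin_gt0.
rewrite {1}(prod_prime_decomp b0) prime_decompE big_map /=.
apply: (@leq_trans (\prod_(p <- primes 'C(2 * n, n)) (2 * n))).
  rewrite !big_seq; apply: leq_prod => p; rewrite mem_primes => /and3P[pp _ _].
  exact: prime_pow_logn_bin_le.
rewrite big_const_seq count_predT iter_muln_1.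
rewrite leq_exp2l; last by lia.
apply: uniq_leq_size; first exact: primes_uniq.
move=> p; rewrite mem_primes mem_primes_upto => /and3P[pp _ pb]; rewrite pp /=.
have : (p %| (2 * n)`!)%N by rewrite -(bin_fact le_n) dvdn_mulr.
by rewrite fact_prod Euclid_dvd_prod // big_has => /hasP[i]; rewrite mem_index_iota => ? /dvdn_leq; lia.
Qed.

Section Euler.
Context {R : realType}.
Implicit Types n m p : nat.

(** Chebyshev's lower bound, by comparing exp2_le_bin with bin_le_prime_count
    at half of n. *)
Lemma prime_count_ge n : (1 < n)%N ->
  n%:R <= 6 * ((size (primes_upto n))%:R * ln n%:R) :> R.
Proof.
move=> n1; set m := n./2.
have m0 : (0 < m)%N by rewrite /m; lia.
have mn : (2 * m <= n)%N by rewrite /m; lia.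
have nm : n%:R <= 3 * m%:R :> R by rewrite -natrM ler_nat /m; lia.
have H : m%:R * ln 2 <= (size (primes_upto (2 * m)))%:R * ln (2 * m)%N%:R :> R.
  rewrite !mulr_natl -!lnXn ?ltr0n //; last by lia.
  rewrite -!natrX ler_lnN ?expn_gt0 //.
  by apply: leq_trans (exp2_le_bin m) (bin_le_prime_count m0).
have H2 : (size (primes_upto (2 * m)))%:R * ln (2 * m)%N%:R <=
    (size (primes_upto n))%:R * ln n%:R :> R.
  apply: ler_pM; rewrite ?lnN_ge0 ?ler_lnN //; last by lia.
  by rewrite ler_nat -(subnKC mn) primes_uptoD size_cat leq_addr.
have [l2 _] := @ln2_bounds R.
have := ler_wpM2l (ler0n R m) l2; lra.
Qed.

(** * Harmonic sums and the Euler product *)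

Lemma harmonic_ge n : ln n.+1%:R <= \sum_(1 <= m < n.+1) m%:R^-1 :> R.
Proof.
elim: n => [|n IHn]; first by rewrite big_geq // ln1.
rewrite big_nat_recr //=; apply: le_trans (lerD IHn (lexx _)).
have := @le_ln1Dx R n.+1%:R^-1.
have n0 : 0 < n.+1%:R :> R by [].
rewrite (_ : 1 + n.+1%:R^-1 = n.+2%:R / n.+1%:R :> R); last first.
  by rewrite -[n.+2%:R]natr1; field; rewrite ?natr1 ?nat1r ?pnatr_eq0 .
rewrite ln_div ?posrE // => h.
have v0 : 0 < n.+1%:R^-1 :> R by rewrite invr_gt0.
have /h h' : -1 < n.+1%:R^-1 :> R := lt_trans (ltrN10 R) v0.
rewrite -lerBlDl; exact: h'.
Qed.

Lemma harmonic_le n : (0 < n)%N ->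
  \sum_(1 <= m < n.+1) m%:R^-1 <= 1 + ln n%:R :> R.
Proof.
case: n => // n _; elim: n => [|n IHn]; first by rewrite big_nat1 ln1 invr1 addr0.
rewrite big_nat_recr //=; apply: le_trans (lerD IHn (lexx _)) _.
have n0 : 0 < n.+1%:R :> R by [].
have n1 : 0 < n.+2%:R :> R by [].
have := @le_ln1Dx R (- n.+2%:R^-1).
rewrite (_ : 1 - n.+2%:R^-1 = n.+1%:R / n.+2%:R :> R); last first.
  by rewrite -[n.+2%:R]natr1; field; rewrite ?natr1 ?nat1r ?pnatr_eq0 .
rewrite ln_div ?posrE // => h.
have : -1 < - n.+2%:R^-1 :> R.
  by rewrite ltrN2 invf_lt1 // ltr1n.
by move=> /h h'; rewrite -addrA lerD2l -lerBrDl -lerN2 opprB.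
Qed.

Lemma ler_sum_subset (T : eqType) (s t : seq T) (F : T -> R) :
  uniq s -> uniq t -> {subset s <= t} -> (forall i, i \in t -> 0 <= F i) ->
  \sum_(i <- s) F i <= \sum_(i <- t) F i.
Proof.
move=> us ut st F0.
have /(perm_big _) -> : perm_eq s [seq i <- t | i \in s].
  apply: uniq_perm; rewrite ?filter_uniq // => i; rewrite mem_filter.
  by case: (boolP (i \in s)) => // /st ->.
rewrite big_filter big_mkcond !big_seq; apply: ler_sum => i /F0.
by case: ifP.
Qed.

Definition smooth (s : seq nat) m := all (mem s) (primes m).

(** Induction on s. Let T be the sum for p :: s. The terms with m prime to p form
    the sum for s, and those with m = p k amount to at most T / p; therefore
    (1 - 1 / p) T is at most the sum for s. *)
Lemma smooth_sum_le (s : seq nat) n : uniq s -> all prime s ->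
  \sum_(1 <= m < n.+1 | smooth s m) m%:R^-1
    <= \prod_(p <- s) (1 - p%:R^-1)^-1 :> R.
Proof.
elim: s => [_ _|p s IHs /= /andP[pNs us] /andP[pp ps]].
  rewrite big_nil; case: n => [|n]; first by rewrite big_geq.
  rewrite big_ltn_cond //= invr1 big_nat_cond big1 ?addr0 // => m.
  move=> /andP[/andP[m1 _]]; rewrite /smooth.
  have : (pdiv m \in primes m) by rewrite mem_primes pdiv_prime // pdiv_dvd ltnW.
  by case: (primes m).
set T := \sum_(1 <= m < n.+1 | smooth (p :: s) m) m%:R^-1.
have p0 : 0 < p%:R :> R by rewrite ltr0n prime_gt0.
have p1 : p%:R^-1 < 1 :> R by rewrite invf_lt1 // ltr1n prime_gt1.
rewrite big_cons mulrC ler_pdivlMr; last by lra.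
apply: le_trans (IHs us ps).
suff : T <= \sum_(1 <= m < n.+1 | smooth s m) m%:R^-1 + p%:R^-1 * T by lra.
rewrite {1}/T (bigID (fun m => p %| m)%N) /= addrC lerD //.
  rewrite big_mkcond [leRHS]big_mkcond /=; apply: ler_sum => m _.
  case: ifP => [/andP[sm pm]|_]; last first.
    by case: ifP => // _; rewrite invr_ge0.
  rewrite /smooth ifT //; apply/allP => q q_m.
  have := allP sm q q_m; rewrite inE => /orP[/eqP qp|//].
  by move: q_m; rewrite qp mem_primes (negbTE pm) !andbF.
pose u m := if smooth (p :: s) m then m%:R^-1 else 0 : R.
have u0 m : 0 <= u m by rewrite /u; case: ifP => // _; rewrite invr_ge0.
have -> : T = \sum_(1 <= k < n.+1) u k by rewrite /T big_mkcond.
pose l := [seq m <- index_iota 1 n.+1 | (p %| m)%N].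
have -> : \sum_(1 <= m < n.+1 | smooth (p :: s) m && (p %| m)%N) m%:R^-1
   = \sum_(m <- l) u m.
  rewrite big_filter [LHS]big_mkcond [RHS]big_mkcond /=; apply: eq_bigr => m _.
  by rewrite /u; case: (p %| m)%N; rewrite ?andbT ?andbF.
apply: (@le_trans _ _ (\sum_(k <- [seq (m %/ p)%N | m <- l]) p%:R^-1 * u k)).
  rewrite big_map !big_seq; apply: ler_sum => m.
  rewrite mem_filter mem_index_iota => /andP[/dvdnP[k ->] mn].
  rewrite mulnK ?prime_gt0 // /u.
  case: ifP => [sm|_]; last by rewrite mulr_ge0 ?invr_ge0 //; exact: u0.
  rewrite ifT ?natrM ?invfM 1?mulrC //; apply/allP => q q_k; apply: (allP sm).
  by move: q_k; rewrite !mem_primes => /and3P[-> k0 /dvdn_mulr->]; rewrite andbT; lia.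
rewrite mulr_sumr; apply: ler_sum_subset; rewrite ?iota_uniq //.
- rewrite map_inj_in_uniq ?filter_uniq ?iota_uniq // => i j.
  rewrite !mem_filter => /andP[/dvdnP[i' ->] _] /andP[/dvdnP[j' ->] _].
  by rewrite !mulnK ?prime_gt0 // => ->.
- move=> k /mapP[m]; rewrite mem_filter !mem_index_iota => /andP[/dvdnP[j ->]].
  have p_gt0 := prime_gt0 pp.
  by rewrite mulnK // => h ->; nia.
- by move=> k _; rewrite mulr_ge0 ?invr_ge0.
Qed.

(** Every m <= n is smooth over the primes up to n. *)
Lemma euler_product_ge n :
  ln n.+1%:R <= \prod_(p <- primes_upto n) (1 - p%:R^-1)^-1 :> R.
Proof.
apply: le_trans (harmonic_ge n) _.
apply: le_trans (smooth_sum_le n (primes_upto_uniq n) (primes_upto_prime n)).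
rewrite [leRHS]big_mkcond /= !big_nat; apply: ler_sum => m /andP[m0 mn].
rewrite ifT //; apply/allP => p; rewrite mem_primes => /and3P[pp _ /dvdn_leq pm].
suff : p \in primes_upto n by [].
by rewrite mem_primes_upto pp; lia.
Qed.
End Euler.

(** * Sums over products of distinct primes, and Rankin's trick *)

(** A squarefree integer composed of the primes in s is represented by the sublist
    of its prime factors. Multiplicative functions are then plain products over
    the list, and identities between sums over divisors go by induction on s. *)
Fixpoint sublists (T : Type) (s : seq T) : seq (seq T) :=
  if s is x :: s' then sublists s' ++ map (cons x) (sublists s') else [:: [::]].

Lemma sublists_subseq (T : eqType) (s D : seq T) : D \in sublists s -> subseq D s.
Proof.
elim: s D => [|x s IHs] D /=; first by rewrite inE => /eqP->.
rewrite mem_cat => /orP[/IHs Ds|/mapP[D' /IHs Ds ->]]; last by rewrite /= eqxx.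
exact: subseq_trans Ds (subseq_cons _ _).
Qed.

Lemma sublists_uniq (T : eqType) (s : seq T) : uniq s -> uniq (sublists s).
Proof.
elim: s => [//|x s IHs] /= /andP[xNs us].
have us' := IHs us.
rewrite cat_uniq us' map_inj_uniq ?us' ?andbT /=; last by move=> a b [].
apply/hasPn => _ /mapP[D Ds ->]; apply/negP => /sublists_subseq /mem_subseq.
by move=> /(_ x (mem_head _ _)); rewrite (negbTE xNs).
Qed.

(** Unique factorisation: a sublist of a list of primes is recovered from its
    product. *)
Lemma sublistsE (s D : seq nat) : uniq s -> all prime s -> D \in sublists s ->
  D = [seq p <- s | (p %| \prod_(q <- D) q)%N].
Proof.
move=> us ps /sublists_subseq sDs; have /(subseq_uniqP us) {1}-> := sDs.
apply: eq_in_filter => p s_p /=; have pp := allP ps p s_p.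
rewrite Euclid_dvd_prod // big_has.
apply/idP/hasP => [Dp|[q Dq]]; first by exists p.
by rewrite dvdn_prime2 ?(allP ps q) ?(mem_subseq sDs) // => /eqP->.
Qed.

Lemma prod_sublists_inj (s : seq nat) : uniq s -> all prime s ->
  {in sublists s &, injective (fun D => \prod_(p <- D) p)%N}.
Proof.
by move=> us ps D E sD sE eqDE; rewrite (sublistsE us ps sD) (sublistsE us ps sE) eqDE.
Qed.

Lemma prod_sublists_gt0 (s D : seq nat) : all prime s -> D \in sublists s ->
  (0 < \prod_(p <- D) p)%N.
Proof.
move=> ps /sublists_subseq /mem_subseq sDs.
by rewrite big_seq prodn_cond_gt0 // => p /sDs /(allP ps) /prime_gt0.
Qed.

Definition bounded_sublists (s : seq nat) z :=
  [seq D <- sublists s | (\prod_(p <- D) p <= z)%N].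

Lemma bounded_sublistsP s z : uniq s -> all prime s ->
  let t := [seq (\prod_(p <- D) p)%N | D <- bounded_sublists s z] in
  uniq t /\ {subset t <= index_iota 1 z.+1}.
Proof.
move=> us ps t; split.
  rewrite map_inj_in_uniq ?filter_uniq ?sublists_uniq // => D E.
  by rewrite !mem_filter => /andP[_ sD] /andP[_ sE]; apply: (prod_sublists_inj us ps).
move=> m /mapP[D]; rewrite mem_filter => /andP[Dz sD] ->.
by rewrite mem_index_iota (prod_sublists_gt0 ps).
Qed.

Lemma size_bounded_sublists s z : uniq s -> all prime s ->
  (size (bounded_sublists s z) <= z)%N.
Proof.
move=> us ps; have [ut st] := bounded_sublistsP z us ps.
by have := uniq_leq_size ut st; rewrite size_map size_iota subn1.
Qed.

Section Rankin.
Context {R : realType}.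
Implicit Types (s D : seq nat) (g : nat -> R).

Lemma sum_sublists g s :
  \sum_(D <- sublists s) \prod_(p <- D) g p = \prod_(p <- s) (1 + g p).
Proof.
elim: s => [|p s IHs] /=; first by rewrite big_seq1 !big_nil.
rewrite big_cat big_map /= IHs big_cons mulrDl mul1r; congr (_ + _).
by under eq_bigr => D _ do rewrite big_cons; rewrite -mulr_sumr IHs.
Qed.

(** The logarithmic derivative of the Euler product of sum_sublists: the weighted
    average of ln d is the sum of the ln p, each weighted by the proportion
    g p / (1 + g p) of the mass that is carried by multiples of p. *)
Lemma sum_sublists_ln g s : all (leq 1) s -> (forall p, p \in s -> 0 <= g p) ->
  \sum_(D <- sublists s) (\prod_(p <- D) g p) * ln (\prod_(p <- D) p)%N%:R =
  (\prod_(p <- s) (1 + g p)) * \sum_(p <- s) g p / (1 + g p) * ln p%:R.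
Proof.
elim: s => [|p s IHs] /=.
  by rewrite big_seq1 !big_nil ln1 mulr0.
move=> /andP[p0 s0] g0.
have gp : 0 <= g p by rewrite g0 ?mem_head.
have g0' q : q \in s -> 0 <= g q by move=> sq; rewrite g0 // inE sq orbT.
rewrite big_cat big_map /= IHs // !big_cons.
have -> : \sum_(D <- sublists s) (\prod_(q <- p :: D) g q) * ln (\prod_(q <- p :: D) q)%N%:R
  = g p * (\sum_(D <- sublists s) (\prod_(q <- D) g q) * ln (\prod_(q <- D) q)%N%:R)
   + g p * ln p%:R * \sum_(D <- sublists s) \prod_(q <- D) g q.
  rewrite !mulr_sumr -big_split /= !big_seq; apply: eq_bigr => D sD.
  rewrite !big_cons natrM lnM ?posrE ?ltr0n //; first by ring.
  have /mem_subseq sDs := sublists_subseq sD.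
  by rewrite big_seq prodn_cond_gt0 // => q /sDs /(allP s0).
rewrite IHs // sum_sublists; field.
by rewrite gt_eqF // ltr_pwDl.
Qed.

(** Rankin's trick. The weight 1 - ln d / ln z is at most 1 for d <= z and at most
    0 beyond, while by hypothesis the average of ln d is at most (ln z) / 2, so
    that the weighted sum is at least half of the Euler product. *)
Lemma rankin_ge g s z : (1 < z)%N -> all (leq 1) s ->
  (forall p, p \in s -> 0 <= g p) ->
  \sum_(p <- s) g p / (1 + g p) * ln p%:R <= ln z%:R / 2 ->
  (\prod_(p <- s) (1 + g p)) / 2 <=
    \sum_(D <- bounded_sublists s z) \prod_(p <- D) g p.
Proof.
move=> z1 s0 g0 le_z.
have lz : 0 < ln z%:R :> R by rewrite ln_gt0 // ltr1n.
set W := \prod_(p <- s) (1 + g p).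
have W0 : 0 <= W.
  by rewrite /W big_seq prodr_ge0 // => p /g0 ?; rewrite addr_ge0.
(* Compare with the sum weighted by 1 - ln d / ln z. *)
apply: (@le_trans _ _ (\sum_(D <- sublists s) (\prod_(p <- D) g p) *
    (1 - ln (\prod_(p <- D) p)%N%:R / ln z%:R))).
  under eq_bigr => D _ do rewrite mulrBr mulr1 mulrA.
  rewrite big_split /= sumrN -mulr_suml sum_sublists_ln // sum_sublists -/W.
  rewrite -mulrA -[X in X - _]mulr1 -mulrBr ler_wpM2l //.
  by rewrite lerBrDl -lerBrDr ler_pdivrMr // mulrC; lra.
rewrite big_filter [leRHS]big_mkcond !big_seq; apply: ler_sum => D sD.
have /mem_subseq sDs := sublists_subseq sD.
have D0 : 0 <= \prod_(p <- D) g p by rewrite big_seq prodr_ge0 // => p /sDs /g0.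
have PD : (0 < \prod_(p <- D) p)%N.
  by rewrite big_seq prodn_cond_gt0 // => q /sDs /(allP s0).
case: leqP => Dz.
  by rewrite -[leRHS]mulr1 ler_wpM2l // lerBlDr lerDl divr_ge0 ?lnN_ge0.
rewrite -(mulr0 (\prod_(p <- D) g p)) ler_wpM2l // subr_le0 ler_pdivlMr // mul1r.
by rewrite ler_lnN // ltnW.
Qed.

(** The linear dependence on the sum S of ln p / p is what matters here: the
    hypothesis of the theorem bounds an average of S, and no average of exp S.
    Choose the truncation z with ln z about 2 S. By rankin_ge half of the product
    is at most the sum of 1 / d over the squarefree d <= z, hence at most the
    harmonic sum, which is about ln z. *)
Lemma prod_1Dinv_le s : uniq s -> all prime s ->
  \prod_(p <- s) (1 + p%:R^-1) <= 4 + 4 * \sum_(p <- s) ln p%:R / p%:R :> R.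
Proof.
move=> us ps; set S := \sum_(p <- s) _.
have S0 : 0 <= S by apply: sumr_ge0 => p _; rewrite divr_ge0 ?lnN_ge0.
(* z is an integer between exp (2 S) and 2 exp (2 S). *)
set E := expR (2 * S).
have E1 : 1 <= E by rewrite /E -[leLHS]expR0 ler_expR; lra.
have [z z1 [Ez zE]] : exists2 z : nat, (1 < z)%N & E <= z%:R /\ z%:R <= 2 * E.
  exists (Num.truncn E).+1; first by rewrite ltnS truncn_gt0.
  split; first exact/ltW/truncnS_gt.
  have : (Num.truncn E)%:R <= E by rewrite truncn_le (le_trans ler01).
  by rewrite -natr1; lra.
have z0 : 0 < z%:R :> R by rewrite ltr0n ltnW.
have Ep : 0 < E by exact: expR_gt0.
have lzlo : 2 * S <= ln z%:R by rewrite -[leLHS]expRK ler_ln ?posrE.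
have lzhi : ln z%:R <= 2 * S + 1.
  have := @ln2_bounds R; have : ln z%:R <= ln (2 * E) by rewrite ler_ln ?posrE ?mulr_gt0.
  by rewrite lnM ?posrE // expRK; lra.
have := @rankin_ge (fun p => p%:R^-1) s z z1.
have -> : all (leq 1) s by apply/allP => p /(allP ps) /prime_gt0.
move=> /(_ isT) h.
have {h} : (\prod_(p <- s) (1 + p%:R^-1)) / 2 <=
    \sum_(D <- bounded_sublists s z) \prod_(p <- D) p%:R^-1 :> R.
  apply: h => [p _|]; first by rewrite invr_ge0.
  suff : \sum_(p <- s) p%:R^-1 / (1 + p%:R^-1) * ln p%:R <= S by lra.
  rewrite /S !big_seq; apply: ler_sum => p /(allP ps) /prime_gt0 p0.
  have q0 : 0 < p%:R :> R by rewrite ltr0n.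
  rewrite mulrC ler_wpM2l ?lnN_ge0 // ler_pdivrMr ?ltr_pwDl ?invr_ge0 //.
  by rewrite mulrDr mulr1 lerDl mulr_ge0 ?invr_ge0.
have [ut st] := bounded_sublistsP z us ps.
have inv0 m : m \in index_iota 1 z.+1 -> 0 <= m%:R^-1 :> R by rewrite invr_ge0.
have h2 := @ler_sum_subset R nat _ _ (fun m => m%:R^-1) ut (iota_uniq _ _) st inv0.
have {h2} : \sum_(D <- bounded_sublists s z) \prod_(p <- D) p%:R^-1 <=
   \sum_(1 <= m < z.+1) m%:R^-1 :> R.
  apply: le_trans h2; rewrite big_map; apply: ler_sum => D _.
  by rewrite prodfV natr_prod.
have := @harmonic_le R z (ltnW z1); lra.
Qed.
End Rankin.

Section Periodic.
Context {R : realType}.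
Implicit Types (f F : nat -> R).

(** * Selberg's sieve *)

(** Chinese remaindering: n runs over a period of length p * m exactly when its
    residues modulo p and modulo m range independently. *)
Lemma sum_coprime_periods f F p m : (0 < p)%N -> (0 < m)%N -> coprime p m ->
  (forall n, f (n %% p)%N = f n) -> (forall n, F (n %% m)%N = F n) ->
  \sum_(n < p * m) f n * F n = (\sum_(r < p) f r) * (\sum_(t < m) F t).
Proof.
move=> p0 m0 cop fp Fm; rewrite mulr_suml.
under [RHS]eq_bigr => r _ do rewrite mulr_sumr.
rewrite pair_big /=.
pose h (n : 'I_(p * m)) := (Ordinal (ltn_pmod n p0), Ordinal (ltn_pmod n m0)).
have h_inj : injective h.
  move=> i j [/eqP ep /eqP em]; apply/val_inj/eqP => /=.
  rewrite -[X in X == _](@modn_small _ (p * m)) // -[X in _ == X](@modn_small _ (p * m)) //.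
  by rewrite chinese_remainder // ep em.
rewrite (reindex h) /=; first by apply: eq_bigr => n _; rewrite fp Fm.
by apply/onW_bij/inj_card_bij => //; rewrite card_prod !card_ord.
Qed.

Lemma sum_prod_periodic (s : seq nat) (f : nat -> nat -> R) :
  uniq s -> all prime s ->
  (forall p n, f p (n %% p)%N = f p n) ->
  \sum_(n < \prod_(p <- s) p) \prod_(p <- s) f p n =
    \prod_(p <- s) \sum_(r < p) f p r.
Proof.
move=> + + f_per; elim: s => [|p s IHs] /=.
  move=> _ _; rewrite !big_nil.
  by rewrite big_ord1 big_nil.
move=> /andP[pNs us] /andP[pp ps]; rewrite !big_cons -IHs //.
under eq_bigr => n _ do rewrite big_cons.
have per n : \prod_(q <- s) f q (n %% \prod_(q <- s) q)%N = \prod_(q <- s) f q n.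
  rewrite [LHS]big_seq [RHS]big_seq; apply: eq_bigr => q sq.
  have dq : (q %| \prod_(q <- s) q)%N by rewrite (big_rem q) //= dvdn_mulr.
  by rewrite -[LHS]f_per (modn_dvdm _ dq) f_per.
apply: (@sum_coprime_periods (f p) (fun n => \prod_(q <- s) f q n)) => //.
- exact: prime_gt0.
- by rewrite big_seq prodn_cond_gt0 // => q /(allP ps) /prime_gt0.
rewrite prime_coprime // Euclid_dvd_prod // big_has; apply/hasPn => q sq.
rewrite dvdn_prime2 ?(allP ps q) //; by apply: contra pNs => /eqP->.
Qed.

(** Complete periods contribute their mean, the last incomplete one at most its
    length. *)
Lemma sum_periodic_le f M N : (0 < M)%N ->
  (forall n, f (n %% M)%N = f n) -> (forall n, f n <= 1) ->
  0 <= \sum_(n < M) f n ->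
  \sum_(n < N) f n <= N%:R / M%:R * (\sum_(n < M) f n) + M%:R.
Proof.
move=> M0 f_per f1 S0; set S := \sum_(n < M) f n.
have E q r : \sum_(n < q * M + r) f n = q%:R * S + \sum_(n < r) f n.
  elim: q => [|q IHq]; first by rewrite mul0r add0r.
  rewrite mulSn -addnA big_split_ord /= -/S -natr1 mulrDl mul1r.
  rewrite [q%:R * S + S]addrC -addrA -IHq; congr (_ + _); apply: eq_bigr => n _.
  by rewrite -f_per modnDl f_per.
have := E (N %/ M)%N (N %% M)%N; rewrite -divn_eq => ->; apply: lerD.
  rewrite ler_wpM2r // ler_pdivlMr ?ltr0n // -natrM ler_nat.
  exact: leq_trunc_div.
apply: (@le_trans _ _ (\sum_(n < N %% M) 1)); first exact: ler_sum.
by rewrite sumr_const card_ord ler_nat ltnW // ltn_pmod.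
Qed.
End Periodic.

Section Selberg.
Context {R : realType}.
Variables (s : seq nat) (Omega : nat -> pred nat) (w : nat -> nat).
Hypotheses (us : uniq s) (ps : all prime s).
Hypothesis Omega_per : forall p n, Omega p (n %% p)%N = Omega p n.
Hypothesis wE : forall p, p \in s -> (\sum_(r < p) Omega p r)%N = w p.
Hypothesis w_le : forall p, p \in s -> (2 * w p <= p)%N.

(** The value which the function sieve_char below must take on the remaining
    classes to have mean 0, given that it is - 1 on the w p removed ones. *)
Definition sieve_density p : R := (w p)%:R / (p - w p)%:R.
Local Notation g := sieve_density.

(** Over a period this has mean 0 and mean square sieve_density p. Its products
    over the sublists D of s are therefore orthogonal functions of n, up to
    incomplete periods. *)
Definition sieve_char p n : R := if Omega p n then -1 else g p.
Local Notation psi := sieve_char.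

Let s_gt0 p : p \in s -> (0 < p)%N.
Proof. by move=> /(allP ps) /prime_gt0. Qed.

Lemma sieve_density_ge0 p : 0 <= g p.
Proof. by rewrite divr_ge0. Qed.

Lemma sieve_density_le1 p : p \in s -> g p <= 1.
Proof.
move=> sp; have := w_le sp; have := s_gt0 sp => p0 wp.
by rewrite ler_pdivrMr ?ltr0n ?mul1r ?ler_nat; lia.
Qed.

Lemma sum_sieve_char p : p \in s -> \sum_(r < p) psi p r = 0.
Proof.
move=> sp; have := w_le sp; have := s_gt0 sp => p0 wp.
have -> : \sum_(r < p) psi p r = \sum_(r < p) (g p - (1 + g p) * (Omega p r)%:R).
  by apply: eq_bigr => r _; rewrite /psi; case: (Omega p r); rewrite ?mulr1 ?mulr0; ring.
rewrite big_split /= sumr_const card_ord sumrN -mulr_sumr -natr_sum wE //.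
rewrite -mulr_natr /g natrB; last by lia.
have : 0 < p%:R - (w p)%:R :> R by rewrite subr_gt0 ltr_nat; lia.
by move=> h; field; rewrite gt_eqF.
Qed.

Lemma sum_sieve_char_sqr p : p \in s -> \sum_(r < p) psi p r ^+ 2 = p%:R * g p.
Proof.
move=> sp; have := w_le sp; have := s_gt0 sp => p0 wp.
have -> : \sum_(r < p) psi p r ^+ 2 = \sum_(r < p) (g p ^+ 2 + (1 - g p ^+ 2) * (Omega p r)%:R).
  by apply: eq_bigr => r _; rewrite /psi; case: (Omega p r); rewrite ?mulr1 ?mulr0; ring.
rewrite big_split /= sumr_const card_ord -mulr_sumr -natr_sum wE //.
rewrite -mulr_natr /g natrB; last by lia.
have : 0 < p%:R - (w p)%:R :> R by rewrite subr_gt0 ltr_nat; lia.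
by move=> h; field; rewrite gt_eqF.
Qed.

Lemma sieve_char_norm p n : p \in s -> `|psi p n| <= 1.
Proof.
move=> sp; rewrite /psi; case: ifP => _; first by rewrite normrN normr1.
by rewrite ger0_norm ?sieve_density_ge0 ?sieve_density_le1.
Qed.

Definition sieve_chars D n : R := \prod_(p <- D) psi p n.

(** The summand has as period the product U of the primes in D or in E. Over a
    complete period the sum factors by sum_prod_periodic; a prime in exactly one
    of D and E gives a factor 0, and for D = E the factors are the mean squares.
    An incomplete period costs at most its length, because the characters are bounded by 1. *)
Lemma sieve_correlation_le D E N : D \in sublists s -> E \in sublists s ->
  \sum_(n < N) sieve_chars D n * sieve_chars E n <=
    (if D == E then N%:R * \prod_(p <- D) g p else 0)
    + (\prod_(p <- D) p * \prod_(p <- E) p)%N%:R.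
Proof.
move=> sD sE; have sDs := sublists_subseq sD; have sEs := sublists_subseq sE.
have /(subseq_uniqP us) DE := sDs; have /(subseq_uniqP us) EE := sEs.
pose U := [seq p <- s | (p \in D) || (p \in E)].
pose f p n := (if p \in D then psi p n else 1) * (if p \in E then psi p n else 1).
have uU : uniq U by rewrite filter_uniq.
have pU : all prime U by apply/allP => p; rewrite mem_filter => /andP[_ /(allP ps)].
have sU p : p \in U -> p \in s by rewrite mem_filter => /andP[].
have f_per p n : f p (n %% p)%N = f p n by rewrite /f /psi Omega_per.
have prodE n : sieve_chars D n * sieve_chars E n = \prod_(p <- U) f p n.
  rewrite /sieve_chars {1}DE {1}EE !big_filter /U.
  rewrite big_mkcond [X in _ * X]big_mkcond -big_split /= [RHS]big_mkcond /=.
  apply: eq_bigr => p _; rewrite /f.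
  by case: (p \in D); case: (p \in E) => //=; rewrite mulr1.
rewrite (eq_bigr (fun n : 'I_N => \prod_(p <- U) f p n)); last by move=> n _; exact: prodE.
set M := (\prod_(p <- U) p)%N.
have M0 : (0 < M)%N by rewrite /M big_seq prodn_cond_gt0 // => q /(allP pU) /prime_gt0.
have M_le : (M <= \prod_(p <- D) p * \prod_(p <- E) p)%N.
  rewrite {1}DE {1}EE !big_filter /M /U big_filter.
  rewrite big_mkcond [X in (_ * X)%N]big_mkcond [X in (X * _)%N]big_mkcond -big_split /=.
  rewrite !big_seq; apply: leq_prod => p /s_gt0 p0.
  by case: (p \in D); case: (p \in E) => //=; rewrite ?mul1n ?muln1 // leq_pmulr.
have SE : \sum_(n < M) \prod_(p <- U) f p n = if D == E then M%:R * \prod_(p <- D) g p else 0.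
  rewrite sum_prod_periodic //; case: eqVneq => [eDE|nDE].
    have UD : U = D by rewrite [RHS]DE /U -eDE; apply: eq_filter => p; rewrite orbb.
    rewrite /M UD natr_prod -big_split /= !big_seq; apply: eq_bigr => p pD.
    rewrite -sum_sieve_char_sqr ?(mem_subseq sDs) //; apply: eq_bigr => r _.
    by rewrite /f -eDE pD expr2.
  have [p sp nDEp] : exists2 p, p \in s & (p \in D) != (p \in E).
    apply/hasP; apply: contraNT nDE => /hasPn same; apply/eqP.
    rewrite DE EE; apply: eq_in_filter => p /same; rewrite negbK => /eqP.
    exact.
  have pU' : p \in U by rewrite mem_filter sp andbT; move: nDEp; do 2 case: (p \in _).
  rewrite (bigD1_seq p) //= (_ : \sum_(r < p) f p r = 0) ?mul0r //.
  rewrite -[RHS](sum_sieve_char sp); apply: eq_bigr => r _; rewrite /f.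
  by move: nDEp; case: (p \in D); case: (p \in E) => //; rewrite ?mulr1 ?mul1r.
have S0 : 0 <= \sum_(n < M) \prod_(p <- U) f p n.
  rewrite SE; case: ifP => // _; apply: mulr_ge0 => //; apply: prodr_ge0 => p _.
  exact: sieve_density_ge0.
have F_per n : \prod_(p <- U) f p (n %% M)%N = \prod_(p <- U) f p n.
  rewrite [LHS]big_seq [RHS]big_seq; apply: eq_bigr => q Uq.
  have dq : (q %| M)%N by rewrite /M (big_rem q) //= dvdn_mulr.
  by rewrite -[LHS]f_per (modn_dvdm _ dq) f_per.
have F1 n : \prod_(p <- U) f p n <= 1.
  rewrite -prodE; apply: le_trans (ler_norm _) _.
  rewrite normrM /sieve_chars !normr_prod mulr_ile1 ?prodr_ge0 //.
    by rewrite big_seq prodr_ile1 // => p pD; rewrite normr_ge0 sieve_char_norm ?(mem_subseq sDs).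
  by rewrite big_seq prodr_ile1 // => p pE; rewrite normr_ge0 sieve_char_norm ?(mem_subseq sEs).
apply: le_trans (@sum_periodic_le R _ M N M0 F_per F1 S0) _.
rewrite lerD ?ler_nat // SE; case: ifP => _; last by rewrite mulr0.
by rewrite mulrA divfK ?pnatr_eq0 -?lt0n.
Qed.

(** Its inverse bounds the proportion of integers that the sieve leaves. *)
Definition sieve_mass z := \sum_(D <- bounded_sublists s z) \prod_(p <- D) g p.

(** Let F n be the sum of the sieve characters over the D with product at most z.
    Where no prime of s forbids n, each character equals its density and F n is
    the sieve mass; so the left-hand side is at most the sum of F n ^+ 2, which
    the near orthogonality of the characters evaluates. This is dual to the usual
    choice of optimal weights and gives the same main term. *)
Lemma selberg_sieve z N :
  (count (fun n => all (fun p => ~~ Omega p n) s) (iota 0 N))%:R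
    * sieve_mass z ^+ 2 <= N%:R * sieve_mass z + (z ^ 4)%N%:R.
Proof.
set G := sieve_mass z; set L := bounded_sublists s z.
have LP D : D \in L -> D \in sublists s /\ (\prod_(p <- D) p <= z)%N.
  by rewrite mem_filter => /andP[].
pose F n := \sum_(D <- L) sieve_chars D n.
have FG n : all (fun p => ~~ Omega p n) s -> F n = G.
  move=> On; rewrite /F /G /sieve_mass !big_seq; apply: eq_bigr => D /LP[/sublists_subseq/mem_subseq sD _].
  rewrite /sieve_chars !big_seq; apply: eq_bigr => p /sD /(allP On).
  by rewrite /psi => /negbTE ->.
apply: (@le_trans _ _ (\sum_(n < N) F n ^+ 2)).
  rewrite -sum1_count natr_sum mulr_suml -{1}[N]subn0 big_mkord.
  rewrite [leLHS]big_mkcond; apply: ler_sum => n _.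
  by case: ifP => [/FG->|_]; rewrite ?mul1r // sqr_ge0.
have -> : \sum_(n < N) F n ^+ 2 =
   \sum_(D <- L) \sum_(E <- L) \sum_(n < N) sieve_chars D n * sieve_chars E n.
  under [RHS]eq_bigr => D _ do rewrite exchange_big /=.
  rewrite [RHS]exchange_big /=; apply: eq_bigr => n _.
  rewrite expr2 {1}/F mulr_suml; apply: eq_bigr => D _.
  by rewrite /F mulr_sumr.
apply: (@le_trans _ _ (\sum_(D <- L) \sum_(E <- L)
   ((if D == E then N%:R * \prod_(p <- D) g p else 0) + (z * z)%N%:R))).
  rewrite [leLHS]big_seq [leRHS]big_seq; apply: ler_sum => D /LP[sD Dz].
  rewrite [leLHS]big_seq [leRHS]big_seq; apply: ler_sum => E /LP[sE Ez].
  apply: le_trans (sieve_correlation_le N sD sE) _.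
  by apply: lerD => //; rewrite ler_nat leq_mul.
have uL : uniq L by rewrite filter_uniq // sublists_uniq.
have szL := size_bounded_sublists z us ps.
under eq_bigr => D _ do rewrite big_split /= big_const_seq count_predT iter_addr_0.
rewrite big_split /= big_const_seq count_predT iter_addr_0 lerD //.
  rewrite /G /sieve_mass mulr_sumr [leLHS]big_seq [leRHS]big_seq; apply: ler_sum => D DL.
  rewrite (bigD1_seq D) //= eqxx [X in _ + X]big1 ?addr0 // => E.
  by rewrite eq_sym => /negbTE->.
rewrite -!mulrnA ler_nat (_ : z ^ 4 = z * z * (z * z))%N; last by rewrite !expnS expn0; lia.
by apply: leq_mul => //; apply: leq_mul.
Qed.
End Selberg.

(** * Prime pairs at a given distance *)

Lemma sum_dvdn_residue p c : (0 < p)%N -> (\sum_(r < p) (p %| r + c) = 1)%N.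
Proof.
move=> p0; pose r0 := Ordinal (ltn_pmod (p - c %% p) p0).
have r0c : (p %| r0 + c)%N.
  by rewrite /dvdn /= modnDml -modnDmr subnK ?modnn // ltnW // ltn_pmod.
rewrite (bigD1 r0) //= -/(nat_of_ord r0) r0c big1 ?addn0 // => r nr.
apply/eqP; rewrite eqb0; apply: contra nr => rc; apply/eqP/val_inj.
have : (r + c == r0 + c %[mod p])%N by move: rc r0c; rewrite /dvdn => /eqP-> /eqP->.
by rewrite eqn_modDr !modn_small // => /eqP.
Qed.

Definition prime_pairs (X h : nat) : nat :=
  count (fun q => prime q && prime (q + h)) (iota 0 X.+1).

Section PrimePairs.
Context {R : realType}.

Lemma ler_prod_subset (T : eqType) (s t : seq T) (F : T -> R) :
  uniq s -> uniq t -> {subset s <= t} -> (forall i, i \in t -> 1 <= F i) ->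
  \prod_(i <- s) F i <= \prod_(i <- t) F i.
Proof.
move=> us ut st F1.
have /(perm_big _) -> : perm_eq s [seq i <- t | i \in s].
  apply: uniq_perm; rewrite ?filter_uniq // => i; rewrite mem_filter.
  by case: (boolP (i \in s)) => // /st ->.
rewrite big_filter big_mkcond [leLHS]big_seq [leRHS]big_seq.
by apply: ler_prod => i /F1; case: ifP; lra.
Qed.

(** This is h / phi(h). *)
Definition euler_ratio h : R := \prod_(p <- primes h) (1 - p%:R^-1)^-1.

Lemma euler_factorE p : (1 < p)%N -> (1 - p%:R^-1)^-1 = p%:R / (p%:R - 1) :> R.
Proof.
move=> p1; have : 1 < p%:R :> R by rewrite ltr1n.
by move=> h; field; rewrite !gt_eqF //; lra.
Qed.

Lemma euler_factor_ge1 p : (1 < p)%N -> 1 <= (1 - p%:R^-1)^-1 :> R.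
Proof.
move=> p1; rewrite euler_factorE //; have : 1 < p%:R :> R by rewrite ltr1n.
by move=> h; rewrite ler_pdivlMr; lra.
Qed.

Lemma euler_ratio_ge1 h : 1 <= euler_ratio h.
Proof.
rewrite /euler_ratio -[leLHS](@big_nil R 1 *%R nat xpredT (fun p => (1 - p%:R^-1)^-1)).
apply: ler_prod_subset; rewrite ?primes_uniq // => p.
by rewrite mem_primes => /and3P[/prime_gt1 p1 _ _]; apply: euler_factor_ge1.
Qed.

Lemma ln_ge1V (v : R) : 0 < v -> 1 - v^-1 <= ln v.
Proof.
move=> v0; have := @le_ln1Dx R (v^-1 - 1).
have vi : 0 < v^-1 by rewrite invr_gt0.
rewrite addrCA subrr addr0 lnV ?posrE //; lra.
Qed.

Lemma sieve_mass_ge1 (s : seq nat) (w : nat -> nat) z :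
  uniq s -> (0 < z)%N -> 1 <= sieve_mass s w z :> R.
Proof.
move=> us z0; rewrite /sieve_mass.
have nil_in : [::] \in bounded_sublists s z.
  rewrite mem_filter big_nil z0 /=.
  by elim: s {us} => //= p s IHs; rewrite mem_cat IHs.
rewrite (bigD1_seq [::]) ?filter_uniq ?sublists_uniq //= big_nil lerDl.
by apply: sumr_ge0 => D _; apply: prodr_ge0 => p _; apply: sieve_density_ge0.
Qed.

Section Fixed_h.
Variables (h y : nat).
Hypotheses (h_gt0 : (0 < h)%N) (y_gt0 : (0 < y)%N).

(** The classes 0 and - h modulo p are forbidden to the smaller prime of a pair.
    For p = 2 and p = 3 only the class 0 is removed: the sieve asks that at most
    half of the classes be removed, and this changes the bound by a constant
    factor only. *)
Definition pair_forbidden p n : bool :=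
  if (p %| 6 * h)%N then (p %| n)%N else (p %| n)%N || (p %| n + h)%N.
Definition pair_forbidden_count p : nat := if (p %| 6 * h)%N then 1%N else 2%N.
Local Notation Omega := pair_forbidden.
Local Notation w := pair_forbidden_count.
Let s := primes_upto y.

Let s_prime p : p \in s -> prime p.
Proof. by rewrite mem_primes_upto => /andP[]. Qed.

Let wE p : p \in s -> (\sum_(r < p) Omega p r)%N = w p.
Proof.
move=> /s_prime pp; have p0 := prime_gt0 pp; rewrite /Omega /w.
have E0 : (\sum_(r < p) (p %| r) = 1)%N.
  by rewrite -[RHS](sum_dvdn_residue 0 p0); apply: eq_bigr => r _; rewrite addn0.
case: ifP => [_|/negbT pNh]; first exact: E0.
transitivity (\sum_(r < p) (p %| r) + \sum_(r < p) (p %| r + h))%N;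
  last by rewrite E0 sum_dvdn_residue.
rewrite -big_split /=; apply: eq_bigr => r _.
case: (boolP (p %| r)%N) => pr //=; rewrite dvdn_addr //.
have -> // : (p %| h)%N = false.
by apply/negbTE; apply: contra pNh; apply: dvdn_mull.
Qed.

Let w_le p : p \in s -> (2 * w p <= p)%N.
Proof.
move=> /s_prime pp; rewrite /w; case: ifP => [_|/negbT pNh].
  by rewrite muln1 prime_gt1.
suff : [&& p != 2, p != 3, p != 0 & p != 1]%N by lia.
apply/and4P; split; apply: contra pNh => /eqP pE; rewrite pE in pp *.
- by rewrite dvdn_mulr.
- by rewrite dvdn_mulr.
- by [].
- by [].
Qed.

(** By rankin_ge the mass is at least half of the product of p / (p - w p) over
    p <= y; the condition on z comes from w p <= 2 and mertens_le. A prime with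
    w p = 2 contributes at least the square of p / (p - 1); for the primes
    dividing 6 h one factor p / (p - 1) is missing, which the denominator
    restores. The full square is bounded below by euler_product_ge. *)
Lemma pair_sieve_mass_ge z : (1 < z)%N -> 4 * ln y%:R + 8 <= ln z%:R :> R ->
  ln y.+1%:R ^+ 2 / (6 * euler_ratio h) <= sieve_mass s w z.
Proof.
move=> z1 lnz.
have E1 := euler_ratio_ge1 h.
have g0 p : 0 <= @sieve_density R w p := sieve_density_ge0 w p.
have H : (\prod_(p <- s) (1 + @sieve_density R w p)) / 2 <= sieve_mass s w z.
  apply: rankin_ge => //; first by apply/allP => p /s_prime /prime_gt0.
  apply: (@le_trans _ _ (\sum_(p <- s) 2 * (ln p%:R / p%:R))); last first.
    by rewrite -mulr_sumr; have := @mertens_le R y y_gt0; lra.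
  rewrite !big_seq; apply: ler_sum => p sp.
  have p0 : 0 < p%:R :> R by rewrite ltr0n prime_gt0 ?s_prime.
  have wp := w_le sp.
  have d0 : 0 < p%:R - (w p)%:R :> R by rewrite subr_gt0 ltr_nat; have := prime_gt0 (s_prime sp); lia.
  have -> : @sieve_density R w p / (1 + sieve_density w p) = (w p)%:R / p%:R.
    rewrite /sieve_density natrB; last by lia.
    by field; rewrite !gt_eqF.
  rewrite mulrAC mulrA ler_pM2r ?invr_gt0 // ler_wpM2r ?lnN_ge0 // ler_nat /w.
  by case: ifP.
apply: le_trans H.
rewrite ler_pdivrMr; last by lra.
rewrite [leRHS](_ : _ = (\prod_(p <- s) (1 + @sieve_density R w p)) * (euler_ratio h * 3));
  last by field.
have l0 : 0 <= ln y.+1%:R :> R := lnN_ge0 _.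
apply: (@le_trans _ _ ((\prod_(p <- s) (1 - p%:R^-1)^-1) ^+ 2)).
  by rewrite ler_pXn2r ?nnegrE // ?euler_product_ge // (le_trans l0) ?euler_product_ge.
have -> : euler_ratio h * 3 = (\prod_(p <- [:: 2; 3]%N) (1 - p%:R^-1)^-1) * euler_ratio h.
  by rewrite !big_cons big_nil; field.
apply: (@le_trans _ _ ((\prod_(p <- s) (1 + @sieve_density R w p)) *
  ((\prod_(p <- s | p \in [:: 2; 3]%N) (1 - p%:R^-1)^-1) *
   (\prod_(p <- s | (p %| h)%N) (1 - p%:R^-1)^-1)))).
  rewrite expr2 -big_split [X in _ * (X * _)]big_mkcond [X in _ * (_ * X)]big_mkcond.
  rewrite -2!big_split /= [leLHS]big_seq [leRHS]big_seq; apply: ler_prod => p sp.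
  have pp := s_prime sp; have p1 := prime_gt1 pp.
  have e1 := euler_factor_ge1 p1.
  apply/andP; split; first by apply: mulr_ge0; lra.
  have p1R : 1 < p%:R :> R by rewrite ltr1n.
  rewrite /sieve_density /w; case: ifP => [p6|/negbT pN6].
    have -> : 1 + 1 / (p - 1)%N%:R = (1 - p%:R^-1)^-1 :> R.
      rewrite euler_factorE // natrB ?(ltnW p1) //.
      by field; rewrite gt_eqF //; lra.
    have : (p \in [:: 2; 3]%N) || (p %| h)%N.
      move: p6; rewrite Euclid_dvdM // (_ : 6 = 2 * 3)%N // Euclid_dvdM //.
      by rewrite (dvdn_prime2 pp (isT : prime 2)) (dvdn_prime2 pp (isT : prime 3)) !inE.
    case: (p \in _) => /=; case: (p %| h)%N => //= _; rewrite ?mulr1 ?mul1r //.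
    by rewrite mulrA ler_peMr // mulr_ge0 //; lra.
  have -> : (p \in [:: 2; 3]%N) = false.
    apply/negbTE; apply: contra pN6; rewrite !inE => /orP[] /eqP->; exact: dvdn_mulr.
  have -> : (p %| h)%N = false.
    by apply/negbTE; apply: contra pN6; apply: dvdn_mull.
  rewrite !mulr1 euler_factorE //.
  have := w_le sp; rewrite /w (negbTE pN6) => p4.
  (* p / (p - 2) exceeds (p / (p - 1))^2. *)
  have p4R : 4 <= p%:R :> R by rewrite ler_nat.
  rewrite natrB; last by lia.
  have -> : 1 + 2 / (p%:R - 2) = p%:R / (p%:R - 2) :> R by field; rewrite gt_eqF //; lra.
  rewrite -subr_ge0.
  have -> : p%:R / (p%:R - 2) - p%:R / (p%:R - 1) * (p%:R / (p%:R - 1)) =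
     p%:R / ((p%:R - 2) * (p%:R - 1) ^+ 2) :> R.
    by field; rewrite !gt_eqF //; lra.
  by rewrite divr_ge0 // mulr_ge0 ?sqr_ge0 //; lra.
apply: ler_wpM2l; first by apply: prodr_ge0 => p _; rewrite addr_ge0.
have nonneg (P : pred nat) : 0 <= \prod_(p <- s | P p) (1 - p%:R^-1)^-1 :> R.
  rewrite big_seq_cond prodr_ge0 // => p /andP[/s_prime /prime_gt1 /euler_factor_ge1]; lra.
apply: ler_pM => //.
  rewrite -big_filter; apply: ler_prod_subset => //.
    exact/filter_uniq/primes_upto_uniq.
    by move=> p; rewrite mem_filter => /andP[].
  by move=> p; rewrite !inE => /orP[] /eqP ->; apply: euler_factor_ge1.
rewrite -big_filter; apply: ler_prod_subset; rewrite ?primes_uniq //.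
  exact/filter_uniq/primes_upto_uniq.
  by move=> p; rewrite mem_filter mem_primes => /andP[-> /s_prime ->]; rewrite h_gt0.
by move=> p; rewrite mem_primes => /and3P[/prime_gt1 p1 _ _]; apply: euler_factor_ge1.
Qed.

(** A prime q > y with q + h prime is left by the sieve over the primes up to y,
    as neither number has a prime factor up to y. *)
Lemma prime_pairs_sieve z X : (1 < z)%N -> 4 * ln y%:R + 8 <= ln z%:R :> R ->
  (prime_pairs X h)%:R <= y.+1%:R +
    X.+1%:R * (6 * euler_ratio h) / ln y.+1%:R ^+ 2 + (z ^ 4)%N%:R.
Proof.
move=> z1 lnz.
have Omega_per p n : Omega p (n %% p)%N = Omega p n.
  by rewrite /Omega /dvdn modn_mod modnDml.
set S := count (fun n => all (fun p => ~~ Omega p n) s) (iota 0 X.+1).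
have le_S : (prime_pairs X h <= y.+1 + S)%N.
  rewrite /prime_pairs.
  apply: (@leq_trans (count (predU (fun q => q < y.+1)%N
     (fun n => all (fun p => ~~ Omega p n) s)) (iota 0 X.+1))).
    apply: sub_count => q /= /andP[pq pqh].
    case: (ltnP q y.+1) => //= yq; apply/allP => p; rewrite mem_primes_upto => /andP[pp py].
    rewrite /Omega.
    have -> : (p %| q)%N = false by rewrite dvdn_prime2 //; lia.
    have -> : (p %| q + h)%N = false by rewrite dvdn_prime2 //; lia.
    by case: ifP.
  have : (count (fun q => q < y.+1) (iota 0 X.+1) <= y.+1)%N.
    rewrite -size_filter -[X in (_ <= X)%N](size_iota 0).
    apply: uniq_leq_size; first by rewrite filter_uniq ?iota_uniq.
    by move=> q; rewrite mem_filter !mem_iota; lia.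
  by have := count_predUI (fun q => q < y.+1)%N
     (fun n => all (fun p => ~~ Omega p n) s) (iota 0 X.+1); rewrite -/S; lia.
have E1 := euler_ratio_ge1 h.
have l0 : 0 < ln y.+1%:R :> R by rewrite lnN_gt0.
have G1 := @sieve_mass_ge1 s w z (primes_upto_uniq y) (ltnW z1).
have := @selberg_sieve R s Omega w (primes_upto_uniq y) (primes_upto_prime y) Omega_per wE w_le z X.+1.
have := pair_sieve_mass_ge z1 lnz.
rewrite -/S; set G := sieve_mass s w z in G1 *; set Z := (z ^ 4)%N%:R.
have Z0 : 0 <= Z by [].
move=> G_ge sel.
apply: (@le_trans _ _ (y.+1%:R + S%:R)); first by rewrite -natrD ler_nat.
rewrite -addrA lerD2l.
have G0 : 0 < G by lra.
have : S%:R <= X.+1%:R / G + Z.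
  have : S%:R <= X.+1%:R / G + Z / G ^+ 2.
    rewrite -(ler_pM2r (exprn_gt0 2 G0)) (le_trans sel) //.
    by rewrite mulrDl expr2 mulrA !divfK ?mulf_neq0 ?gt_eqF.
  move/le_trans; apply; rewrite lerD2l ler_pdivrMr ?exprn_gt0 //.
  by rewrite ler_peMr // expr_ge1 //; lra.
move/le_trans; apply; rewrite lerD2r -mulrA ler_wpM2l //.
rewrite -[leRHS]invrK lef_pV2 ?posrE ?invr_gt0 //.
  by rewrite invfM invrK mulrC.
by rewrite divr_gt0 ?exprn_gt0 //; lra.
Qed.
End Fixed_h.

(** The sieve with y a small fixed power of X and z a constant multiple of
    y ^ 4: the main term then has the order X / (ln X)^2 and both error terms are
    bounded by powers of X below X. *)
Lemma prime_pairs_le : exists2 K : R, 0 < K &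
  forall X h, (1 < X)%N -> (0 < h)%N ->
    (prime_pairs X h)%:R * ln X%:R ^+ 2 <= K * X%:R * euler_ratio h.
Proof.
have [c c0 lnc] : exists2 c, (1 < c)%N & 8 <= ln c%:R :> R.
  have e0 := expR_gt0 (8 : R).
  have h := truncnS_gt (expR (8 : R)).
  exists (Num.truncn (expR (8 : R))).+1.
    rewrite ltnS truncn_gt0; have := expR_ge1Dx (8 : R); lra.
  by rewrite -[leLHS]expRK ler_ln ?posrE // ltW.
(* y is the integer part of the d-th root of X. The largest power of y among the
   error terms is z ^ 4 * L ^+ 2, of degree 16 + 2 in y. *)
have [d d18] : exists d, (18 <= d)%N by exists 18.
have d0 : 0 < d%:R :> R by rewrite ltr0n (leq_trans _ d18).
have c40 : 0 <= c%:R ^+ 4 :> R by rewrite exprn_ge0.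
exists (d%:R ^+ 2 * (c%:R ^+ 4 + 16)).
  by apply: mulr_gt0; [rewrite exprn_gt0 | lra].
move=> X h X1 h0.
have [y y0 [yX Xy]] : exists2 y, (0 < y)%N & (y ^ d <= X)%N /\ (X <= y.+1 ^ d)%N.
  have ex : exists y, (y ^ d <= X)%N by exists 1%N; rewrite exp1n ltnW.
  have bd y : (y ^ d <= X)%N -> (y <= X)%N.
    move=> yX; apply: leq_trans yX; case: y => // y.
    by rewrite -{1}[y.+1]expn1 leq_pexp2l // (leq_trans _ d18).
  case: (ex_maxnP ex bd) => y yX y_max; exists y.
    by apply: y_max; rewrite exp1n ltnW.
  split=> //; rewrite leqNgt; apply/negP => /ltnW /y_max; rewrite ltnn //.
have z1 : (1 < c * y ^ 4)%N by rewrite (leq_trans c0) // leq_pmulr // expn_gt0 y0.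
have lz : 4 * ln y%:R + 8 <= ln (c * y ^ 4)%N%:R :> R.
  rewrite natrM natrX lnM ?posrE ?exprn_gt0 ?ltr0n ?(ltnW c0) //.
  by rewrite lnXn ?ltr0n // -[X in _ + X]mulr_natl; lra.
have := prime_pairs_sieve h0 y0 X z1 lz.
have := euler_ratio_ge1 h; set E := euler_ratio h => E1.
set l := ln y.+1%:R => H.
have l0 : 0 < l by rewrite lnN_gt0.
have ly : l <= y%:R.
  by have := @le_ln1Dx R y%:R; rewrite -/l nat1r; apply; have := ler0n R y; lra.
set L := ln X%:R.
have L0 : 0 <= L := lnN_ge0 X.
have Ll : L <= d%:R * l.
  by rewrite mulr_natl -lnXn // -natrX ler_lnN // ltnW.
have y1 : 1 <= y%:R :> R by rewrite ler1n.
have L2 : L ^+ 2 <= d%:R ^+ 2 * l ^+ 2.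
  rewrite (_ : d%:R ^+ 2 * l ^+ 2 = (d%:R * l) ^+ 2); last by rewrite exprMn.
  by rewrite ler_pXn2r ?nnegrE // mulr_ge0 // ltW.
have L2y : L ^+ 2 <= d%:R ^+ 2 * y%:R ^+ 2.
  apply: le_trans L2 _; rewrite ler_pM2l ?exprn_gt0 //.
  by rewrite ler_pXn2r ?nnegrE // ltW.
have powX k : (k <= d)%N -> y%:R ^+ k <= X%:R :> R.
  move=> kd; rewrite -natrX ler_nat; apply: leq_trans yX.
  by rewrite leq_pexp2l.
have X0 : 0 <= X%:R :> R by [].
have A1 : y.+1%:R * L ^+ 2 <= d%:R ^+ 2 * (2 * X%:R).
  apply: (@le_trans _ _ ((2 * y%:R) * (d%:R ^+ 2 * y%:R ^+ 2))).
    by apply: ler_pM => //; rewrite ?sqr_ge0 // -natr1; lra.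
  rewrite (_ : _ * _ = d%:R ^+ 2 * (2 * y%:R ^+ 3)); last by ring.
  by rewrite ler_wpM2l ?sqr_ge0 // ler_pM2l // powX // (leq_trans _ d18).
have A2 : X.+1%:R * (6 * E) / l ^+ 2 * L ^+ 2 <= d%:R ^+ 2 * (12 * (X%:R * E)).
  apply: (@le_trans _ _ ((2 * X%:R) * (6 * E) / l ^+ 2 * (d%:R ^+ 2 * l ^+ 2))); last first.
    rewrite [leLHS](_ : _ = d%:R ^+ 2 * (12 * (X%:R * E))) //.
    by field; rewrite gt_eqF.
  have X1R : 1 <= X%:R :> R by rewrite ler1n ltnW.
  have E6 : 0 <= 6 * E by lra.
  apply: ler_pM; [|exact: sqr_ge0| |exact: L2].
    by rewrite divr_ge0 ?sqr_ge0 // mulr_ge0.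
  rewrite ler_wpM2r ?invr_ge0 ?sqr_ge0 // ler_wpM2r //.
  by rewrite -natr1; lra.
have A3 : ((c * y ^ 4) ^ 4)%N%:R * L ^+ 2 <= d%:R ^+ 2 * (c%:R ^+ 4 * X%:R).
  rewrite natrX natrM natrX.
  apply: (@le_trans _ _ ((c%:R * y%:R ^+ 4) ^+ 4 * (d%:R ^+ 2 * y%:R ^+ 2))).
    by rewrite ler_wpM2l // exprn_ge0 // mulr_ge0 // exprn_ge0.
  rewrite (_ : _ * _ = d%:R ^+ 2 * (c%:R ^+ 4 * y%:R ^+ 18)); last by ring.
  by rewrite ler_wpM2l ?sqr_ge0 // ler_wpM2l // powX.
apply: le_trans (ler_wpM2r (sqr_ge0 L) H) _.
rewrite !(mulrDl _ _ (L ^+ 2)); apply: le_trans (lerD (lerD A1 A2) A3) _.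
have XE : X%:R <= X%:R * E by rewrite ler_peMr.
have B := ler_wpM2l c40 XE.
rewrite -!mulrDr.
rewrite [leRHS](_ : _ = d%:R ^+ 2 * (c%:R ^+ 4 * (X%:R * E) + 16 * (X%:R * E)));
  last by ring.
by apply: ler_wpM2l; [exact: sqr_ge0 | lra].
Qed.

(** The product telescopes to 2 (n + 1) / (n + 2). *)
Lemma prod_inv1Bsqr_le n :
  \prod_(2 <= m < n.+2) (1 - m%:R^-1 ^+ 2)^-1 <= 2 :> R.
Proof.
have -> : \prod_(2 <= m < n.+2) (1 - m%:R^-1 ^+ 2)^-1 = 2 * n.+1%:R / n.+2%:R :> R.
  elim: n => [|n IHn]; first by rewrite big_geq //; field.
  rewrite big_nat_recr //= IHn -[n.+3%:R]natr1 -[n.+2%:R]natr1 -[n.+1%:R]natr1.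
  have n0 : 0 <= n%:R :> R by [].
  field; rewrite !gt_eqF //; try lra.
  by nra.
rewrite ler_pdivrMr // ler_pM2l // ler_nat //.
Qed.

(** 1 / (1 - 1/p) is (1 + 1/p) / (1 - 1/p^2), and the product of the
    1 / (1 - 1/p^2) converges. *)
Lemma euler_ratio_le_prod1D h : (0 < h)%N ->
  euler_ratio h <= 2 * \prod_(p <- primes h) (1 + p%:R^-1).
Proof.
move=> h0.
have -> : euler_ratio h = (\prod_(p <- primes h) (1 - p%:R^-1 ^+ 2)^-1) *
   \prod_(p <- primes h) (1 + p%:R^-1).
  rewrite /euler_ratio -big_split /= !big_seq; apply: eq_bigr => p.
  rewrite mem_primes => /and3P[/prime_gt1 p1 _ _].
  have p1R : 1 < p%:R :> R by rewrite ltr1n.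
  field; rewrite !gt_eqF //; try lra.
  by nra.
rewrite ler_wpM2r //; first by apply: prodr_ge0 => p _; rewrite addr_ge0 ?invr_ge0.
apply: le_trans (prod_inv1Bsqr_le h).
apply: ler_prod_subset; rewrite ?primes_uniq ?iota_uniq //.
  move=> p; rewrite mem_primes mem_index_iota => /and3P[/prime_gt1 -> _ /dvdn_leq].
  by lia.
move=> m; rewrite mem_index_iota => /andP[m2 _].
have m1 : 1 < m%:R :> R by rewrite ltr1n.
have mi : 0 < m%:R^-1 :> R by rewrite invr_gt0; lra.
have mi1 : m%:R^-1 < 1 :> R by rewrite invf_lt1 //; lra.
have q : 0 < 1 - m%:R^-1 ^+ 2 :> R by rewrite subr_gt0 expr_lt1 // ltW.
by rewrite -[leLHS]invr1 lef_pV2 ?posrE // gerBl sqr_ge0.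
Qed.

Lemma size_primes_ln_le h : (0 < h)%N -> (size (primes h))%:R * ln 2 <= ln h%:R :> R.
Proof.
move=> h0; rewrite mulr_natl -lnXn // -natrX ler_lnN ?expn_gt0 //.
apply: (@leq_trans (\prod_(p <- primes h) p)).
  apply: (@leq_trans (\prod_(p <- primes h) 2)).
    by rewrite big_const_seq count_predT iter_muln_1.
  rewrite !big_seq; apply: leq_prod => p.
  by rewrite mem_primes => /and3P[/prime_gt1].
apply: dvdn_leq => //.
have := @prod_prime_pow_dvd (primes h) (fun=> 1%N) h (primes_uniq h).
under eq_bigr => p _ do rewrite expn1.
apply; first by apply/allP => p; rewrite mem_primes => /and3P[].
by move=> p; rewrite mem_primes expn1 => /and3P[].
Qed.

(** Write L = ln x. The primes p <= L^alpha dividing h are left to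
    prod_1Dinv_le; the product over the other ones is at most the exponential of
    their sum of 1/p. Between L^alpha and L this sum is at most
    (ln L + 2) / (alpha ln L) by mertens_le, since 1/p <= (ln p / p) / (alpha ln L)
    there; beyond L it is at most the number of prime factors of h, which is at
    most 2 L, divided by L. *)
Lemma euler_ratio_le (alpha : R) : 0 < alpha ->
  exists2 C : R, 0 < C &
  forall (x : R) h, 10 <= x -> (0 < h)%N -> h%:R <= x ->
    euler_ratio h <= C * (1 + \sum_(p <- primes h | p%:R <= ln x `^ alpha)
                               ln p%:R / p%:R).
Proof.
move=> a0; exists (8 * expR (7 / alpha + 2)); first by rewrite mulr_gt0 ?expR_gt0.
move=> x h x10 h0 hx.
apply: le_trans (euler_ratio_le_prod1D h0) _.
have -> : 8 * expR (7 / alpha + 2) = 2 * (4 * expR (7 / alpha + 2)) by ring.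
rewrite -mulrA ler_pM2l //.
set L := ln x; set S := \sum_(p <- _ | _) _.
rewrite (bigID (fun p => p%:R <= L `^ alpha)) /= [leLHS]mulrC.
have ppr p : p \in primes h -> prime p by rewrite mem_primes => /and3P[].
rewrite [leRHS](_ : _ = expR (7 / alpha + 2) * (4 * (1 + S))); last by ring.
apply: ler_pM.
- by apply: prodr_ge0 => p _; rewrite addr_ge0 ?invr_ge0.
- by apply: prodr_ge0 => p _; rewrite addr_ge0 ?invr_ge0.
- apply: (@le_trans _ _ (expR (\sum_(p <- primes h | ~~ (p%:R <= L `^ alpha)) p%:R^-1))).
    rewrite expR_sum; apply: ler_prod => p _.
    by rewrite expR_ge1Dx addr_ge0 ?invr_ge0.
  rewrite ler_expR.
  have [l2 _] := @ln2_bounds R.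
  have L32 : 3 / 2 <= L.
    apply: (@le_trans _ _ (ln 8)); last by rewrite ler_ln ?posrE; lra.
    rewrite (_ : 8 = 2 ^+ 3); last by ring.
    by rewrite lnXn // -mulr_natl; lra.
  have L0 : 0 < L by lra.
  have lL : 1 / 3 <= ln L.
    have := ln_ge1V L0; have : L^-1 <= (3 / 2)^-1 by rewrite lef_pV2 ?posrE //; lra.
    by rewrite invf_div; lra.
  have lL0 : 0 < ln L by lra.
  rewrite (bigID (fun p => p%:R <= L)) /= lerD //.
    set W := [seq p <- primes h | ~~ (p%:R <= L `^ alpha) && (p%:R <= L)].
    rewrite -big_filter -/W.
    have W_sub : {subset W <= primes_upto (Num.truncn L)}.
      move=> p; rewrite mem_filter => /andP[/andP[_ pL] /ppr pp].
      by rewrite mem_primes_upto pp truncn_ge_nat // ltW.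
    apply: (@le_trans _ _ (\sum_(p <- W) (alpha * ln L)^-1 * (ln p%:R / p%:R))).
      rewrite !big_seq; apply: ler_sum => p.
      rewrite mem_filter -ltNge => /andP[/andP[pL _] /ppr /prime_gt0 p0].
      rewrite mulrA -[leLHS]mul1r ler_wpM2r ?invr_ge0 // mulrC ler_pdivlMr ?mulr_gt0 // mul1r.
      rewrite -ln_powR ler_ln ?posrE ?ltr0n ?powR_gt0 //; exact: ltW.
    rewrite -mulr_sumr mulrC ler_pdivrMr ?mulr_gt0 //.
    apply: (@le_trans _ _ (ln L + 2)); last first.
      by rewrite mulrA divfK ?gt_eqF //; lra.
    have trL : (0 < Num.truncn L)%N by rewrite truncn_gt0; lra.
    apply: (@le_trans _ _ (ln (Num.truncn L)%:R + 2)); last first.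
      by rewrite lerD2r ler_ln ?posrE ?ltr0n // truncn_le ltW.
    apply: le_trans (mertens_le trL).
    apply: ler_sum_subset; rewrite ?primes_upto_uniq ?filter_uniq ?primes_uniq //.
    by move=> p _; rewrite divr_ge0 ?lnN_ge0.
  apply: (@le_trans _ _ (\sum_(p <- primes h) L^-1)).
    rewrite big_mkcond /= !big_seq; apply: ler_sum => p.
    case: ifP => [/andP[_]|_]; last by rewrite invr_ge0 ltW.
    rewrite -ltNge => Lp _; rewrite lef_pV2 ?posrE ?ltW //; exact: lt_trans Lp.
  rewrite big_const_seq count_predT iter_addr_0 -[leLHS]mulr_natl ler_pdivrMr //.
  have lh : ln h%:R <= L by rewrite ler_ln ?posrE ?ltr0n //; lra.
  have := size_primes_ln_le h0.
  have := ler_wpM2l (ler0n R (size (primes h))) l2; lra.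
rewrite /S -big_filter -[in leRHS]big_filter mulrDr mulr1.
apply: prod_1Dinv_le; first by rewrite filter_uniq ?primes_uniq.
by apply/allP => p; rewrite mem_filter => /andP[_ /ppr].
Qed.
End PrimePairs.

(** * Moments of the number of representations *)

Definition is_shift (n v : nat) : bool := (v <= n)%N && prime (n - v).

(** The number of representations of n as a prime plus an entry of b, where b
    lists with multiplicity the terms of the sequence that are at most x. *)
Definition shift_count (b : seq nat) (n : nat) : nat := count (is_shift n) b.

Lemma shift_countE b n : shift_count b n = (\sum_(v <- b) is_shift n v)%N.
Proof.
by rewrite /shift_count -sum1_count big_mkcond; apply: eq_bigr => v _; case: (is_shift n v).
Qed.

Lemma count_sum_iota (P : pred nat) m : count P (iota 0 m) = (\sum_(n < m) P n)%N.
Proof.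
rewrite -sum1_count -{1}[m]subn0 big_mkord big_mkcond.
by apply: eq_bigr => n _; case: (P n).
Qed.

Lemma half_bounds X : (10 <= X)%N ->
  [/\ 1 < X %/ 2, X %/ 2 <= X & X + 1 <= 3 * (X %/ 2)]%N.
Proof. by split; lia. Qed.

(** Only the entries v <= X / 2 are used; each is a shift of n = v + p for all
    primes p <= X / 2. *)
Lemma shift_first_moment b X :
  (count (fun v => 2 * v <= X) b * size (primes_upto (X %/ 2)) <=
    \sum_(n < X.+1) shift_count b n)%N.
Proof.
under eq_bigr => n _ do rewrite shift_countE.
rewrite exchange_big /= -sum1_count big_distrl /= big_mkcond /=.
apply: leq_sum => v _; case: ifP => // vX; rewrite mul1n.
rewrite -(count_sum_iota (fun n => is_shift n v)) -size_filter -(size_map (addn v)).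
apply: uniq_leq_size.
  by rewrite map_inj_uniq ?primes_upto_uniq //; apply: addnI.
move=> n /mapP[p]; rewrite mem_primes_upto => /andP[pp pX] ->.
by rewrite mem_filter mem_iota /is_shift leq_addr addKn pp /=; lia.
Qed.

(** Expand the square: a pair (u, v) of entries is counted once for each n with
    both n - u and n - v prime. For u < v the primes n - v and n - u form a pair
    at distance v - u; the case v < u is symmetric. *)
Lemma shift_second_moment b X :
  (\sum_(n < X.+1) shift_count b n ^ 2 <=
    size (primes_upto X) * \sum_(v <- b) count_mem v b +
    2 * \sum_(u <- b) \sum_(v <- b | u < v) prime_pairs X (v - u))%N.
Proof.
pose c u v := (\sum_(n < X.+1) is_shift n u * is_shift n v)%N.
have cE u v : c u v = count (fun n => is_shift n u && is_shift n v) (iota 0 X.+1).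
  by rewrite count_sum_iota; apply: eq_bigr => n _; rewrite mulnb.
have c_sym u v : c u v = c v u by apply: eq_bigr => n _; rewrite mulnC.
have c_diag u : (c u u <= size (primes_upto X))%N.
  rewrite cE -size_filter -[X in (_ <= X)%N](size_map (addn u)).
  apply: uniq_leq_size; first by rewrite filter_uniq ?iota_uniq.
  move=> n; rewrite mem_filter mem_iota andbb => /andP[/andP[un pn] nX].
  apply/mapP; exists (n - u)%N; last by rewrite subnKC.
  by rewrite mem_primes_upto pn; lia.
have c_off u v : (u < v)%N -> (c u v <= prime_pairs X (v - u))%N.
  move=> uv; rewrite cE /prime_pairs -!size_filter -[X in (_ <= X)%N](size_map (addn v)).
  apply: uniq_leq_size; first by rewrite filter_uniq ?iota_uniq.
  move=> n; rewrite mem_filter mem_iota => /andP[/andP[/andP[un pu] /andP[vn pv]] nX].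
  apply/mapP; exists (n - v)%N; last by rewrite subnKC.
  rewrite mem_filter mem_iota pv (_ : n - v + (v - u) = n - u)%N; last by lia.
  by rewrite pu /=; lia.
have -> : (\sum_(n < X.+1) shift_count b n ^ 2 = \sum_(u <- b) \sum_(v <- b) c u v)%N.
  under [RHS]eq_bigr => u _ do rewrite exchange_big /=.
  rewrite [RHS]exchange_big /=; apply: eq_bigr => n _.
  rewrite -mulnn shift_countE big_distrl /=; apply: eq_bigr => u _.
  by rewrite big_distrr.
pose P u v := (if (u < v)%N then prime_pairs X (v - u) else 0)%N.
apply: (@leq_trans (\sum_(u <- b) \sum_(v <- b)
  ((if u == v then size (primes_upto X) else 0) + (P u v + P v u)))%N).
  apply: leq_sum => u _; apply: leq_sum => v _; rewrite /P.
  case: ltngtP => uv; rewrite ?addn0 ?add0n.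
  - exact: c_off.
  - by rewrite c_sym; exact: c_off.
  - by rewrite uv.
under eq_bigr => u _ do rewrite !big_split /=.
rewrite !big_split /= leq_add //.
  rewrite big_distrr /=; apply: leq_sum => u _.
  rewrite -sum1_count big_distrr /= [X in (_ <= X)%N]big_mkcond /=.
  by apply: leq_sum => v _; rewrite eq_sym muln1.
rewrite [X in (_ + X)%N]exchange_big /= addnn -mul2n leq_mul2l /=.
by apply: leq_sum => u _; rewrite [X in (_ <= X)%N]big_mkcond.
Qed.

Section Core.
Context {R : realType}.

Lemma sqr_sum_le (I : Type) (s : seq I) (P : pred I) (F : I -> R) :
  (\sum_(i <- s | P i) F i) ^+ 2 <= (count P s)%:R * \sum_(i <- s | P i) F i ^+ 2.
Proof.
rewrite -sum1_count natr_sum expr2 !mulr_suml.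
have H : \sum_(i <- s | P i) F i * (\sum_(j <- s | P j) F j) <=
   \sum_(i <- s | P i) \sum_(j <- s | P j) (F i ^+ 2 + F j ^+ 2) / 2.
  apply: ler_sum => i _; rewrite mulr_sumr; apply: ler_sum => j _.
  have := sqr_ge0 (F i - F j); rewrite sqrrB; lra.
apply: le_trans H _.
have E1 : \sum_(i <- s | P i) \sum_(j <- s | P j) F i ^+ 2 =
   \sum_(i <- s | P i) \sum_(j <- s | P j) F j ^+ 2 by rewrite exchange_big.
have -> : \sum_(i <- s | P i) \sum_(j <- s | P j) (F i ^+ 2 + F j ^+ 2) / 2 =
  ((\sum_(i <- s | P i) \sum_(j <- s | P j) F i ^+ 2) +
   (\sum_(i <- s | P i) \sum_(j <- s | P j) F j ^+ 2)) / 2.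
  rewrite -big_split /= mulr_suml; apply: eq_bigr => i _.
  by rewrite -big_split /= mulr_suml.
rewrite E1 -mulr2n -[_ *+ 2]mulr_natr mulfK ?pnatr_eq0 //.
by apply: ler_sum => i _; rewrite mul1r.
Qed.

(** Interchange of summation, in which p divides v - u exactly when u and v are
    congruent modulo p; it turns the bound of euler_ratio_le, summed over the
    pairs u < v, into the sum that the hypothesis of the theorem controls. *)
Lemma sum_small_divisors (b : seq nat) (w : R) : 0 <= w ->
  \sum_(u <- b) \sum_(v <- b | (u < v)%N)
     \sum_(p <- primes (v - u) | p%:R <= w) ln p%:R / p%:R =
  \sum_(u <- b) \sum_(p <- primes_upto (Num.truncn w))
     (count (fun v => (u < v)%N && (v == u %[mod p])%N) b)%:R * ln p%:R / p%:R :> R.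
Proof.
move=> w0; apply: eq_bigr => u _.
have E v : (u < v)%N -> \sum_(p <- primes (v - u) | p%:R <= w) ln p%:R / p%:R =
  \sum_(p <- primes_upto (Num.truncn w) | (p %| v - u)%N) ln p%:R / p%:R :> R.
  move=> uv; rewrite -big_filter -[RHS]big_filter; apply: perm_big.
  apply: uniq_perm; rewrite ?filter_uniq ?primes_uniq ?iota_uniq // => p.
  rewrite !mem_filter mem_primes mem_iota subn_gt0 uv add0n ltnS truncn_ge_nat //=.
  by case: (prime p); case: (p %| v - u)%N; case: (p%:R <= w).
rewrite (eq_bigr _ E).
under eq_bigr => v _ do rewrite big_mkcond /=.
rewrite exchange_big /=; apply: eq_bigr => p _.
rewrite -mulrA -sum1_count natr_sum mulr_suml [LHS]big_mkcond [RHS]big_mkcond /=.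
apply: eq_bigr => v _; case: ltnP => //= uv.
by rewrite eqn_mod_dvd ?(ltnW uv) // mul1r.
Qed.

(** The theorem for the finite multiset of the terms at most x. *)
Lemma many_large_shift_counts (gamma1 gamma2 alpha : R) :
  0 < gamma1 -> 0 < gamma2 -> 0 < alpha ->
  exists2 c2 : R, 0 < c2 &
  forall (x : R) (b : seq nat) (rho : nat),
    10 <= x ->
    (0 < size b)%N ->
    gamma1 * (size b)%:R <= (count (fun v => 2 * v <= Num.truncn x)%N b)%:R ->
    {in b, forall v, (v <= Num.truncn x)%N} ->
    {in b, forall v, (count_mem v b <= rho)%N} ->
    \sum_(u <- b) \sum_(p <- primes_upto (Num.truncn (ln x `^ alpha)))
      (count (fun v => (u < v)%N && (v == u %[mod p])%N) b)%:R * ln p%:R / p%:R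
      <= gamma2 * (size b)%:R ^+ 2 ->
    c2 * x * ((size b)%:R / ((size b)%:R + rho%:R * ln x)) <=
      (count (fun n => gamma1 / 72 * ((size b)%:R / ln x) <= (shift_count b n)%:R)
         (iota 0 (Num.truncn x).+1))%:R.
Proof.
move=> g1 g2 a0.
have [K K0 HK] := @prime_pairs_le R.
have [C C0 HC] := euler_ratio_le a0.
pose Q := 12 + 8 * (K * C) * (1 + gamma2).
have KC0 : 0 < K * C by rewrite mulr_gt0.
have Q0 : 0 < Q by rewrite /Q ltr_wpDr // mulr_ge0 //; lra.
exists ((gamma1 / 36) ^+ 2 / Q).
  by rewrite divr_gt0 // exprn_gt0 // divr_gt0.
move=> x b rho x10 b0 Hhalf Hb Hrho Hcong.
set X := Num.truncn x in Hhalf Hb *.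
have xge0 : 0 <= x by lra.
have xgt0 : 0 < x by lra.
have Xx : X%:R <= x by rewrite truncn_le.
have xX : x < X.+1%:R by exact: truncnS_gt.
have X10 : (10 <= X)%N by rewrite truncn_ge_nat.
clearbody X.
have X10R : 10 <= X%:R :> R by rewrite ler_nat.
have xX' : x < X%:R + 1 by rewrite natr1.
set N := (size b)%:R in Hhalf Hcong *.
have N0 : 0 < N by rewrite ltr0n.
set L := ln x.
have L0 : 0 < L by rewrite ln_gt0 //; lra.
have lX : ln X%:R <= L by rewrite ler_ln ?posrE //; lra.
have Ll : L <= 2 * ln X%:R.
  rewrite mulr_natl -lnXn; last lra.
  by rewrite ler_ln ?posrE ?exprn_gt0 //; nra.
have lX0 : 0 < ln X%:R :> R by lra.
set w := ln x `^ alpha in Hcong.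
have w0 : 0 <= w by exact: powR_ge0.
pose r n : R := (shift_count b n)%:R.
pose T := gamma1 / 72 * (N / L).
have T0 : 0 < T by rewrite mulr_gt0 // divr_gt0.
pose I := iota 0 X.+1.
have sumI (F : nat -> R) : \sum_(n <- I) F n = \sum_(n < X.+1) F n.
  by rewrite -(big_mkord xpredT F) /index_iota subn0.
pose M0 := gamma1 * N * (x / (18 * L)).
have M0_ge0 : 0 < M0 by rewrite !mulr_gt0 // invr_gt0 mulr_gt0.
have first : M0 <= \sum_(n <- I) r n.
  rewrite sumI -natr_sum.
  apply: (@le_trans _ _ (count (fun v => 2 * v <= X)%N b * size (primes_upto (X %/ 2)))%N%:R); last first.
    by rewrite ler_nat shift_first_moment.
  rewrite natrM; apply: ler_pM => //.
  - by rewrite mulr_ge0 //; lra.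
  - by rewrite divr_ge0 // mulr_ge0 // ltW.
  set m := (X %/ 2)%N.
  have [m1 m_le mX] := half_bounds X10; rewrite -/m in m1 m_le mX.
  have x3 : x <= 3 * m%:R by apply: le_trans (ltW xX) _; rewrite -natrM ler_nat -addn1.
  have lm : ln m%:R <= L.
    by apply: le_trans lX; rewrite ler_lnN // ltnW.
  have := @prime_count_ge R m m1.
  have := ler_wpM2l (ler0n R (size (primes_upto m))) lm.
  rewrite ler_pdivrMr ?mulr_gt0 // => h1 h2; lra.
pose E := fun n => T <= r n.
(* T is chosen so that 2 x T is half of the lower bound M0 for the first moment. *)
have large : M0 / 2 <= \sum_(n <- I | E n) r n.
  have : \sum_(n <- I | ~~ E n) r n <= M0 / 2.
    apply: (@le_trans _ _ (\sum_(n <- I) T)).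
      rewrite big_mkcond; apply: ler_sum => n _.
      by rewrite /E -ltNge; case: ifP => [/ltW//|_]; exact: ltW.
    rewrite big_const_seq count_predT iter_addr_0 size_iota -[leLHS]mulr_natl.
    have -> : M0 / 2 = (2 * x) * T.
      by rewrite /M0 /T; field; rewrite gt_eqF.
    by rewrite ler_pM2r // -natr1; lra.
  by move: first; rewrite (bigID E) /=; lra.
have rho0 : 0 <= rho%:R :> R by [].
have second : \sum_(n <- I | E n) r n ^+ 2 <= Q * x * N * (N + rho%:R * L) / L ^+ 2.
  have step1 : \sum_(n <- I | E n) r n ^+ 2 <= \sum_(n <- I) r n ^+ 2.
    by rewrite [leLHS]big_mkcond; apply: ler_sum => n _; case: ifP => // _; exact: sqr_ge0.
  apply: le_trans step1 _; rewrite sumI.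
  under eq_bigr => n _ do rewrite /r -natrX.
  rewrite -natr_sum.
  have := shift_second_moment b X; rewrite -(ler_nat R) => /le_trans; apply.
  rewrite natrD !natrM.
  have diag : (size (primes_upto X))%:R * (\sum_(v <- b) count_mem v b)%N%:R <=
     12 * x / L * (N * rho%:R) :> R.
    apply: ler_pM => //.
      rewrite ler_pdivlMr //.
      have X0 : (0 < X)%N := leq_trans (isT : (0 < 10)%N) X10.
      have := @prime_count_le R X X0.
      have := ler_wpM2l (ler0n R (size (primes_upto X))) Ll; lra.
    rewrite -natrM ler_nat -[size b]sum1_size big_distrl /= !big_seq.
    by apply: leq_sum => v /Hrho; rewrite mul1n.
  have off : (\sum_(u <- b) \sum_(v <- b | (u < v)%N) prime_pairs X (v - u))%N%:R <=
     4 * (K * C) * x / L ^+ 2 * ((1 + gamma2) * N ^+ 2) :> R.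
    apply: (@le_trans _ _ (\sum_(u <- b) \sum_(v <- b | (u < v)%N)
       4 * (K * C) * x / L ^+ 2 *
       (1 + \sum_(p <- primes (v - u) | p%:R <= w) ln p%:R / p%:R))).
      rewrite natr_sum !big_seq; apply: ler_sum => u ub.
      rewrite natr_sum big_seq_cond [leRHS]big_seq_cond; apply: ler_sum => v /andP[vb uv].
      have h0 : (0 < v - u)%N by rewrite subn_gt0.
      have hx : (v - u)%N%:R <= x.
        by apply: le_trans Xx; rewrite ler_nat (leq_trans (leq_subr _ _)) // Hb.
      have X1 : (1 < X)%N := leq_trans (isT : (1 < 10)%N) X10.
      have A := HK X (v - u)%N X1 h0.
      have B := HC x (v - u)%N x10 h0 hx.
      set S := 1 + _ in B *.
      rewrite mulrAC ler_pdivlMr ?exprn_gt0 //.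
      apply: (@le_trans _ _ (4 * ((prime_pairs X (v - u))%:R * ln X%:R ^+ 2))).
        have : L ^+ 2 <= 4 * ln X%:R ^+ 2.
          rewrite (_ : 4 * _ = (2 * ln X%:R) ^+ 2); last by ring.
          by rewrite ler_pXn2r ?nnegrE ?mulr_ge0 // ltW.
        have p0 : 0 <= (prime_pairs X (v - u))%:R :> R by [].
        by move/(ler_wpM2l p0); lra.
      have E1 := @euler_ratio_ge1 R (v - u)%N.
      rewrite [leRHS](_ : _ = 4 * (K * (x * (C * S)))); last by ring.
      rewrite ler_pM2l //; apply: le_trans A _; rewrite -mulrA ler_pM2l //.
      apply: ler_pM => //; exact: le_trans ler01 E1.
    rewrite (eq_bigr (fun u => 4 * (K * C) * x / L ^+ 2 * \sum_(v <- b | (u < v)%N)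
       (1 + \sum_(p <- primes (v - u) | p%:R <= w) ln p%:R / p%:R))); last first.
      by move=> u _; rewrite mulr_sumr.
    rewrite -mulr_sumr ler_wpM2l //.
      by rewrite divr_ge0 ?sqr_ge0 // mulr_ge0 // mulr_ge0 // ltW.
    under eq_bigr => u _ do rewrite big_split /=.
    rewrite big_split /= sum_small_divisors // mulrDl mul1r lerD //.
    rewrite expr2 {1}/N -{1}sum1_size natr_sum mulr_suml; apply: ler_sum => u _.
    rewrite mul1r /N -sum1_size natr_sum [leLHS]big_mkcond /=.
    by apply: ler_sum => v _; case: ifP.
  apply: le_trans (lerD diag (ler_wpM2l (ler0n R 2) off)) _.
  rewrite ler_pdivlMr ?exprn_gt0 //.
  have -> : (12 * x / L * (N * rho%:R) +
     2%:R * (4 * (K * C) * x / L ^+ 2 * ((1 + gamma2) * N ^+ 2))) * L ^+ 2 =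
     12 * (x * N * (rho%:R * L)) + 8 * (K * C) * (1 + gamma2) * (x * N * N).
    by field; rewrite gt_eqF.
  have -> : Q * x * N * (N + rho%:R * L) =
     12 * (x * N * (rho%:R * L)) + 8 * (K * C) * (1 + gamma2) * (x * N * N)
     + (12 * (x * N * N) + 8 * (K * C) * (1 + gamma2) * (x * N * (rho%:R * L))).
    by rewrite /Q; ring.
  rewrite lerDl addr_ge0 // !mulr_ge0 //; lra.
have D0 : 0 < N + rho%:R * L by rewrite ltr_wpDr // mulr_ge0 // ltW.
have main := sqr_sum_le I E r.
have cnt0 : 0 <= (count E I)%:R :> R by [].
have main2 : (M0 / 2) ^+ 2 <= (count E I)%:R * (Q * x * N * (N + rho%:R * L) / L ^+ 2).
  apply: le_trans (_ : _ <= (\sum_(n <- I | E n) r n) ^+ 2) _.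
    rewrite ler_pXn2r ?nnegrE //; first lra.
    by apply: le_trans large; lra.
  by apply: le_trans main _; rewrite ler_wpM2l.
have F0 : 0 < Q * x * N * (N + rho%:R * L) / L ^+ 2.
  by rewrite divr_gt0 ?exprn_gt0 // !mulr_gt0.
rewrite -(ler_pM2r F0); apply: le_trans main2.
rewrite le_eqVlt; apply/orP; left; apply/eqP; rewrite /M0.
by field; rewrite !gt_eqF.
Qed.
End Core.

(** * From the sequence to the multiset of its terms up to x *)

Lemma ncard_count (T : choiceType) (S : set T) (s : seq T) (P : pred T) :
  uniq s -> (forall t, S t <-> t \in s /\ P t) -> ncard S = count P s.
Proof.
move=> us SP; rewrite /ncard.
have -> : S = [set` [fset t in [seq t <- s | P t]]%fset].
  apply/seteqP; split => t /=; rewrite !inE mem_filter.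
    by move=> /SP[-> ->].
  by move=> /andP[Pt st]; apply/SP.
by rewrite set_fsetK card_fseq undup_id ?filter_uniq // size_filter.
Qed.

Lemma fsbig_uniq_seq (R : realType) (S : set nat) (s : seq nat) (F : nat -> R) :
  uniq s -> (forall t, S t <-> t \in s) -> \sum_(t \in S) F t = \sum_(t <- s) F t.
Proof.
move=> us SP; rewrite (fsbig_seq _ _ us).
by have -> : S = [set` s] by apply/seteqP; split => t /SP.
Qed.

Section Transfer.
Context {R : realType}.
Variables (a : nat -> nat) (x : R) (J : seq nat).
Hypotheses (a_gt0 : forall j, (0 < a j)%N) (x_ge0 : 0 <= x).
Hypotheses (uJ : uniq J) (mem_J : forall j, (j \in J) = (a j <= Num.truncn x)%N).

Let b := [seq a j | j <- J].

Let leP n : (n%:R <= x) = (n <= Num.truncn x)%N.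
Proof. by rewrite truncn_ge_nat. Qed.

Lemma countA_size : countA a x = size b.
Proof.
rewrite /countA (@ncard_count _ _ J predT) ?count_predT ?size_map // => j /=.
by rewrite leP mem_J; split=> [|[]].
Qed.

Lemma countA_half : countA a (x / 2) = count (fun v => 2 * v <= Num.truncn x)%N b.
Proof.
rewrite /countA (@ncard_count _ _ J (fun j => 2 * a j <= Num.truncn x)%N) ?count_map // => j /=.
rewrite ler_pdivlMr // -natrM mulnC leP mem_J; split=> [h|[]//]; split=> //; lia.
Qed.

Lemma ordA_count n : (n <= Num.truncn x)%N -> ordA a n = count_mem n b.
Proof.
move=> nx; rewrite /ordA (@ncard_count _ _ J (fun j => a j == n)) ?count_map // => j /=.
by rewrite mem_J; split=> [->|[_ /eqP]].
Qed.

Lemma count_mem_rhoA : {in b, forall v, (count_mem v b <= rhoA a x)%N}.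
Proof.
move=> v /mapP[j Jj ->]; rewrite mem_J in Jj; rewrite -ordA_count // /rhoA.
apply: (@leq_bigmax_seq _ _ (fun=> true) (fun n => ordA a n)) => //.
by rewrite mem_index_iota a_gt0 ltnS.
Qed.

Lemma reprA_shift_count n : (n <= Num.truncn x)%N -> reprA a n = shift_count b n.
Proof.
move=> nx; rewrite /reprA (@ncard_count _ _ [seq ((n - a j)%N, j) | j <- J]
  (fun pj => is_shift n (a pj.2))); last first.
- move=> [p j] /=; rewrite /is_shift; split.
    move=> [pp def_n]; rewrite -def_n leq_addl addnK pp; split=> //.
    apply/mapP; exists j; last by rewrite addnK.
    by rewrite mem_J (leq_trans _ nx) // -def_n leq_addl.
  by move=> [/mapP[i _ [-> ->]] /andP[an pn]]; rewrite subnK.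
- by rewrite map_inj_uniq // => i j [].
by rewrite /shift_count !count_map; apply: eq_count.
Qed.

Lemma congA_count k p :
  congA a x k p = count (fun v => (a k < v)%N && (v == a k %[mod p])%N) b.
Proof.
rewrite /congA (@ncard_count _ _ J (fun j => (a k < a j)%N && (a j == a k %[mod p])%N)) ?count_map // => j /=.
rewrite leP mem_J; split=> [[-> -> /eqP ->]//|[-> /andP[-> /eqP]]].
by [].
Qed.

(** The terms with a k = x, present on the right only, contribute nothing because
    no a j with a k < a j is at most x. *)
Lemma congA_sum (w : R) : 0 <= w ->
  \sum_(k \in [set k : nat | (a k)%:R < x])
    \sum_(p \in [set p : nat | prime p /\ p%:R <= w])
       ((congA a x k p)%:R * ln (p%:R : R) / p%:R) =
  \sum_(u <- b) \sum_(p <- primes_upto (Num.truncn w))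
      (count (fun v => (u < v)%N && (v == u %[mod p])%N) b)%:R * ln p%:R / p%:R.
Proof.
move=> w0.
rewrite (@fsbig_uniq_seq _ _ [seq k <- J | (a k)%:R < x]); last first.
- move=> k; rewrite mem_filter mem_J -leP /=.
  by split=> [kx|/andP[]//]; rewrite kx ltW.
- exact: filter_uniq.
rewrite big_filter big_map big_mkcond /=; apply: eq_bigr => k _.
case: ifPn => [_|]; last first.
  rewrite -leNgt => xk; rewrite big1 // => p _.
  rewrite (_ : count _ _ = 0%N) ?mul0r //.
  apply/eqP; rewrite -leqn0 leqNgt -has_count; apply/hasPn => v /mapP[j Jj ->].
  rewrite negb_and -leqNgt; apply/orP; left.
  by rewrite -(ler_nat R) (le_trans _ xk) // leP -mem_J.
rewrite (@fsbig_uniq_seq _ _ (primes_upto (Num.truncn w))) ?primes_upto_uniq //.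
  by apply: eq_bigr => p _; rewrite congA_count.
move=> p; rewrite mem_primes_upto truncn_ge_nat //=.
by split=> [[-> ->]|/andP[]].
Qed.
End Transfer.

Lemma truncn_fibres (R : realType) (a : nat -> nat) (x : R) :
  (forall j, (0 < a j)%N) ->
  (forall n, (0 < n)%N -> finite_set [set j : nat | a j = n]) ->
  exists2 J : seq nat, uniq J & forall j, (j \in J) = (a j <= Num.truncn x)%N.
Proof.
move=> a_gt0 a_fin.
have fin : finite_set [set j : nat | (a j <= Num.truncn x)%N].
  apply: (@sub_finite_set _ _ (\bigcup_(n in `I_(Num.truncn x).+1) [set j | a j = n])).
    by move=> j /= aj; exists (a j).
  apply: bigcup_finite; first exact: finite_II.
  move=> [|n] _; last exact: a_fin.
  rewrite (_ : [set j | a j = 0%N] = set0); first exact: finite_set0.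
  by apply/seteqP; split=> j //= aj; have := a_gt0 j; rewrite aj.
exists (enum_fset (fset_set [set j : nat | (a j <= Num.truncn x)%N])); first exact: fset_uniq.
move=> j; apply/idP/idP.
  by rewrite in_fset_set // inE.
by move=> aj; rewrite in_fset_set // inE.
Qed.

Theorem theorem1p6 (R : realType) :
  forall gamma1 : R, 0 < gamma1 ->
  exists2 c1 : R, 0 < c1 &
  forall gamma2 alpha : R, 0 < gamma2 -> 0 < alpha ->
  exists2 c2 : R, 0 < c2 &
  forall (a : nat -> nat) (x0 : R),
    (forall j : nat, (0 < a j)%N) ->
    (forall n : nat, (0 < n)%N -> finite_set [set j : nat | a j = n]) ->
    10 <= x0 ->
    (forall x : R, x0 <= x ->
      [/\ (0 < countA a x)%N,
          gamma1 * (countA a x)%:R <= (countA a (x / 2))%:R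
        & \sum_(k \in [set k : nat | (a k)%:R < x])
            \sum_(p \in [set p : nat | prime p /\ p%:R <= ln x `^ alpha])
              ((congA a x k p)%:R * ln (p%:R : R) / p%:R)
          <= gamma2 * (countA a x)%:R ^+ 2]) ->
    forall x : R, x0 <= x ->
      c2 * x * ((countA a x)%:R / ((countA a x)%:R + (rhoA a x)%:R * ln x))
        <= (ncard [set n : nat |
             [/\ (1 <= n)%N, n%:R <= x
               & c1 * ((countA a x)%:R / ln x) <= (reprA a n)%:R]])%:R
      /\
      c2 * x * ((countA a x)%:R / ((countA a x)%:R + (rhoA a x)%:R * ln x))
        <= (ncard [set n : nat |
             [/\ (1 <= n)%N, n%:R <= x
               & exists p j : nat, prime p /\ (p + a j)%N = n]])%:R.
Proof.
move=> gamma1 g1; exists (gamma1 / 72); first by rewrite divr_gt0.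
move=> gamma2 alpha g2 a0.
have [c2 c20 core] := many_large_shift_counts g1 g2 a0.
exists c2 => // a x0 a_gt0 a_fin x0_ge10 Hx x x0x.
have x10 : 10 <= x by exact: le_trans x0x.
have x_ge0 : 0 <= x by exact: le_trans x10.
have [J uJ mem_J] := truncn_fibres x a_gt0 a_fin.
have [N0 Hhalf Hcong] := Hx x x0x.
set b := [seq a j | j <- J].
have bE := countA_size x_ge0 uJ mem_J.
rewrite (congA_sum x_ge0 uJ mem_J (powR_ge0 _ _)) in Hcong.
rewrite (countA_half x_ge0 uJ mem_J) in Hhalf.
rewrite bE in N0 Hhalf Hcong *; rewrite -/b in N0 Hhalf Hcong *.
have Hb : {in b, forall v, (v <= Num.truncn x)%N}.
  by move=> v /mapP[j Jj ->]; rewrite -mem_J.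
have := core x b (rhoA a x) x10 N0 Hhalf Hb (count_mem_rhoA a_gt0 uJ mem_J) Hcong.
set T := gamma1 / 72 * _; set lower := c2 * x * _ => main.
have T0 : 0 < T.
  rewrite /T mulr_gt0 ?divr_gt0 // ?ltr0n // ln_gt0 //.
  by apply: lt_le_trans x10; rewrite ltr1n.
have shift0 : shift_count b 0 = 0%N.
  apply/eqP; rewrite -leqn0 leqNgt -has_count; apply/hasPn => v _.
  by rewrite /is_shift sub0n andbF.
have mem_I n : (n \in iota 0 (Num.truncn x).+1) = (n%:R <= x).
  by rewrite mem_iota /= ltnS truncn_ge_nat.
split.
  rewrite (@ncard_count _ _ (iota 0 (Num.truncn x).+1) (fun n => T <= (shift_count b n)%:R)) //.
    exact: iota_uniq.
  move=> n /=; rewrite mem_I; split.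
    move=> [n1 nx]; rewrite (reprA_shift_count uJ mem_J) //.
    by rewrite truncn_ge_nat.
  move=> [nx Tn]; split=> //; last first.
    by rewrite (reprA_shift_count uJ mem_J) // truncn_ge_nat.
  by case: n Tn {nx} => // ; rewrite shift0 leNgt T0.
apply: le_trans main _.
rewrite (@ncard_count _ _ (iota 0 (Num.truncn x).+1) (fun n => 0 < shift_count b n)%N).
- rewrite ler_nat; apply: sub_count => n /= Tn.
  by rewrite -(ltr0n R); apply: lt_le_trans Tn.
- exact: iota_uniq.
move=> n /=; rewrite mem_I; split.
  move=> [n1 nx [p [j [pp def_n]]]]; split=> //.
  rewrite /shift_count -has_count; apply/hasP; exists (a j).
    apply/map_f; rewrite mem_J -def_n in nx *.
    by apply: leq_trans (leq_addl p (a j)) _; rewrite truncn_ge_nat.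
  by rewrite /is_shift -def_n leq_addl addnK.
move=> [nx n_pos]; split=> //; first by case: n n_pos {nx} => //; rewrite shift0.
move: n_pos; rewrite /shift_count -has_count => /hasP[v /mapP[j Jj ->] /andP[an pn]].
by exists (n - a j)%N, j; rewrite subnK.
Qed.
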